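(* Let $\{(S_n,J_n);n\ge0\}$ be a discrete-time Markov additive process as in the context satisfying the assumptions listed there, with mean drift $h$, and let $M_n=\max_{0\le k\le n}S_k$. Let $T$ be a nonnegative random variable independent of $\{(S_n,J_n)\}$. Suppose that $T\in\mathcal{C}$, $\mathbb{E}[T]<\infty$, and (entrywise) $$\int_{|y|>x}d\boldsymbol{\beta}(y)=o(\mathbb{P}(T>x)),\qquad \int_{|y|>x}d\boldsymbol{H}(y)=o(\mathbb{P}(T>x)).$$ Then $\mathbb{P}(S_{\lfloor T\rfloor}>hx)\sim\mathbb{P}(M_{\lfloor T\rfloor}>hx)\sim\mathbb{P}(T>x)$ as $x\to\infty$.
   Context: Let $\mathbb{D}=\{0,1,\dots,d-1\}$. $\{J_n\}$ is a Markov chain on $\mathbb{D}$ and $X_0,X_1,\dots$ are real random variables such that $\mathbb{P}(X_0\le x,J_0=i)=\beta_i(x)$ and, for $n\ge0$, conditionally on the past up to time $n$ and on $J_n=i$, $\mathbb{P}(X_{n+1}\le x,J_{n+1}=j\mid\cdot)=H_{i,j}(x)$, where $\sum_i\beta_i(\infty)=1$ and $\sum_jH_{i,j}(\infty)=1$. Let $S_n=\sum_{\nu=0}^nX_\nu$, $\boldsymbol{\beta}(x)=(\beta_i(x))_{i}$ (row vector), $\boldsymbol{H}(x)=(H_{i,j}(x))_{i,j}$. Assumptions: $\boldsymbol{H}(\infty)$ is an irreducible stochastic matrix, and $h:=\boldsymbol{\varpi}\int_{\mathbb{R}}x\,d\boldsymbol{H}(x)\mathbf{e}\in(0,\infty)$,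 where $\boldsymbol{\varpi}$ is the stationary probability vector of $\boldsymbol{H}(\infty)$ and $\mathbf{e}$ the all-ones column vector. $f\sim g$ means $f/g\to1$, $f=o(g)$ means $f/g\to0$. Class $\mathcal{C}$: nonnegative $X$ with $\mathbb{P}(X>x)>0$ for all $x\ge0$ and $\lim_{v\downarrow1}\liminf_{x\to\infty}\mathbb{P}(X>vx)/\mathbb{P}(X>x)=1$. *)

(* Defs.v *)
From HB Require Import structures.
From mathcomp Require Import all_boot all_order all_algebra.
From mathcomp Require Import all_classical all_reals all_analysis.
Set Implicit Arguments. Unset Strict Implicit. Unset Printing Implicit Defensive.
Import Order.TTheory GRing.Theory Num.Theory.
Import numFieldNormedType.Exports.
Local Open Scope classical_set_scope.
Local Open Scope ring_scope.

Section Defs.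
Context {R : realType} {d0 : measure_display} {Omega : measurableType d0}.

Definition liminf_pinfty (f : R -> R) : \bar R :=
  ereal_sup [set ereal_inf [set (f x)%:E | x in `]M, +oo[] | M in [set: R]].

Definition tailP (P : probability Omega R) (T : Omega -> R) (x : R) : R :=
  fine (P [set w | x < T w]).

Definition classC (P : probability Omega R) (T : Omega -> R) : Prop :=
  (forall w, 0 <= T w) /\
  (forall x, 0 <= x -> (0%:E < P [set w | (x < T w)%R])%E) /\
  (liminf_pinfty (fun x => tailP P T (v * x) / tailP P T x) @[v --> 1^'+]
     --> (1%:E : \bar R)).

Definition cyl (d : nat) (X : nat -> Omega -> R) (J : nat -> Omega -> 'I_d)
  (n : nat) (B : nat -> set R) (C : nat -> set 'I_d) : set Omega :=
  [set w | forall k, (k <= n)%N -> B k (X k w) /\ C k (J k w)].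

Definition Ssum (X : nat -> Omega -> R) (n : nat) (w : Omega) : R :=
  \sum_(0 <= k < n.+1) X k w.

Definition Smax (X : nat -> Omega -> R) (n : nat) (w : Omega) : R :=
  \big[Num.max/Ssum X 0 w]_(0 <= k < n.+1) Ssum X k w.

End Defs.

(* Main.v *)
(* With [G x = P(T > x)] and [f x = E (T - x)^+], the proof rests on a large
   deviation bound for [S_k] minus a line of slope slightly above [h].  Solving the
   Poisson equation [(H(oo) - 1) g = h - m], where [m] is the vector of mean
   increments, and adding [g(J_n) - g(J_(n-1))] to the increments makes them centred
   given the present state, so that the chain only matters through a finite family
   of step laws with negative mean [- eps] and tails [o(G)].
   Let [r n x] be the largest probability that a walk with steps from this family
   exceeds [x] within [n] steps.  Since [G] is consistently varying, [f] is a
   Lyapunov function of such a walk, whence [r n x -> 0] uniformly in [n]; and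
   [r n (3u) <= (r n u)^2 + n o(G u)], because exceeding [3u] without a jump above
   [u] requires crossing two levels [u].  As [G] is dominatedly varying the two
   facts give [r n x = o((n + 1) G x)] uniformly in [n].
   For [v > 1] close to [1], on [T <= x / v] the event [M_[T] > h x] thus has
   probability [o(E(T + 1) G x)], while [P(T > x / v)] is close to [G x].  Applied
   to [- X], the bound [r n x -> 0] shows that on [T > v x] the event
   [S_[T] <= h x] is negligible with respect to [G x]. *)
Require Import Defs.
From HB Require Import structures.
From mathcomp Require Import all_boot all_order all_algebra.
From mathcomp Require Import all_classical all_reals all_analysis.
From mathcomp Require Import measurable_realfun.
From mathcomp Require Import ring lra.
Import Order.TTheory GRing.Theory Num.Theory.
Import numFieldNormedType.Exports.
Local Open Scope classical_set_scope.
Local Open Scope ring_scope.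

(** * Consistently varying tails *)

Section tail.
Context {R : realType}.

(** Two constraints shape the proof. The deviation bound must hold for all [n] at once and grow at
    most linearly in [n]: only [E T] is finite, so averaging over [T] can pay for a factor [n + 1].
    And the steps have a finite first moment but no assumed higher one, with tails known only to be
    negligible against [G], so exponential or second-moment inequalities are out of reach. The
    function [f] answers the second constraint: it is at most [f 0] on the half-line and decreases
    at rate [G x], so a drift [- eps] gains about [eps G x] per step, while a jump over the whole
    distance costs [f 0] times [o(G x)]. Gain and loss live on the same scale. Letting an adversary
    choose the law of each step replaces conditional probabilities by a deterministic recursion on
    real functions; the Markov property then enters through a single comparison. The room for the
    extra slope, the deviation and the initial value [X_0] is the gap between [h x / v] and
    [h x]. *)

Lemma near_pinftyM (c : R) (Q : R -> Prop) : 0 < c ->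
  (\forall x \near +oo, Q x) -> \forall x \near +oo, Q (c * x).
Proof.
move=> c0 [M [_ HM]]; near=> x; apply: HM; rewrite mulrC -ltr_pdivrMr//.
by near: x; apply: nbhs_pinfty_gt; rewrite num_real.
Unshelve. all: by end_near. Qed.

Lemma near_pinftyD (c : R) (Q : R -> Prop) :
  (\forall x \near +oo, Q x) -> \forall x \near +oo, Q (x + c).
Proof.
move=> [M [_ HM]]; near=> x; apply: HM; rewrite -ltrBlDr.
by near: x; apply: nbhs_pinfty_gt; rewrite num_real.
Unshelve. all: by end_near. Qed.

Lemma expr_unbounded (v b : R) : 1 < v -> exists k, b <= v ^+ k.
Proof.
move=> v1; exists (Num.bound (b / (v - 1))).
have bern k : 1 + (v - 1) * k%:R <= v ^+ k.
  elim: k => [|k IH]; first by rewrite mulr0 addr0 expr0.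
  have vk : 1 <= v ^+ k by rewrite exprn_ege1// ltW.
  rewrite exprS; move: IH vk; rewrite -natr1; nra.
apply: le_trans (bern _); rewrite -lerBlDl -ler_pdivrMl ?subr_gt0//.
rewrite mulrC mulrBl; apply: (@le_trans _ _ (b / (v - 1))).
  by rewrite lerBlDr lerDl mul1r invr_ge0 subr_ge0 ltW.
exact/ltW/unstable.ltr_bound.
Qed.

Variable G : R -> R.
Hypothesis G_gt0 : forall x, 0 < G x.
Hypothesis G_noninc : nonincreasing_fun G.
Hypothesis G_consistent : forall eta, 0 < eta ->
  exists2 v, 1 < v & \forall x \near +oo, (1 - eta) * G x <= G (v * x).

(** With [eta = 1/2], one dilation by [v] at most halves [G]. Iterating until [v ^+ k] exceeds
    [rho^-1] gives [D = 2 ^+ k]. *)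
Lemma consistent_dominated rho : 0 < rho ->
  exists2 D, 0 < D & \forall x \near +oo, G (rho * x) <= D * G x.
Proof.
move=> rho0; have [v v1 vG] : exists2 v, 1 < v &
    \forall x \near +oo, (1 - 2^-1) * G x <= G (v * x).
  by apply: G_consistent; rewrite invr_gt0.
have v0 : 0 < v by exact: lt_trans v1.
have H k : \forall x \near +oo, G x <= 2 ^+ k * G (v ^+ k * x).
  elim: k => [|k IH]; first by near=> x; rewrite !expr0 !mul1r.
  have IH' := near_pinftyM _ _ (exprn_gt0 k v0) vG.
  near=> x.
  have h1 : G x <= 2 ^+ k * G (v ^+ k * x) by near: x.
  have h2 : (1 - 2^-1) * G (v ^+ k * x) <= G (v * (v ^+ k * x)) by near: x.
  apply: le_trans h1 _; rewrite exprS -mulrA mulrCA ler_pM2l ?exprn_gt0//.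
  by rewrite exprS -mulrA; move: h2; lra.
have [k hk] := expr_unbounded v rho^-1 v1.
exists (2 ^+ k); first by rewrite exprn_gt0.
have Hk := near_pinftyM _ _ rho0 (H k).
near=> x.
apply: (@le_trans _ _ (2 ^+ k * G (v ^+ k * (rho * x)))); first by near: x.
rewrite ler_pM2l ?exprn_gt0//; apply: G_noninc.
rewrite mulrA -[leLHS]mul1r ler_pM2r; last first.
  by near: x; apply: nbhs_pinfty_gt; rewrite num_real.
by rewrite -ler_pdivrMr// mul1r.
Unshelve. all: by end_near. Qed.

(** Far out, a shift by [2 K] is weaker than a dilation: [x + K <= v * (x - K)] as soon as
    [x >= (v + 1) K / (v - 1)]. *)
Lemma consistent_long_tailed K eta : 0 < eta ->
  \forall x \near +oo, (1 - eta) * G (x - K) <= G (x + K).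
Proof.
move=> eta0; have [v v1 vG] := G_consistent _ eta0.
have vG' := near_pinftyD (- K) _ vG.
near=> x.
apply: (@le_trans _ _ (G (v * (x - K)))); first by near: x.
apply: G_noninc.
have : (v + 1) * K / (v - 1) <= x.
  by near: x; apply: nbhs_pinfty_ge; rewrite num_real.
rewrite ler_pdivrMr ?subr_gt0//; lra.
Unshelve. all: by end_near. Qed.

End tail.

(** * Crossing probabilities of walks with negative drift *)

Lemma integrable_bounded {R : realType} {d0} {T : measurableType d0}
    (m : {measure set T -> \bar R}) (f : T -> R) (c : R) :
  m setT = 1%E -> measurable_fun setT f -> (forall x, `|f x| <= c) ->
  m.-integrable setT (EFin \o f).
Proof.
move=> m1 mf fc; apply: measurable_bounded_integrable => //.
  by rewrite m1 ltry.
by exists c; split; [exact: num_real|move=> y cy x _ /=; rewrite (le_trans (fc x))// ltW].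
Qed.

Section integrable_EFin.
Context {R : realType} {d0} {T : measurableType d0} {m : {measure set T -> \bar R}}.

Lemma integrable_EFinD (f g : T -> R) : m.-integrable setT (EFin \o f) ->
  m.-integrable setT (EFin \o g) ->
  m.-integrable setT (EFin \o (fun x => f x + g x)).
Proof. by move=> mf mg; exact: (integrableD measurableT mf mg). Qed.

Lemma integrable_EFinZ (c : R) (f : T -> R) : m.-integrable setT (EFin \o f) ->
  m.-integrable setT (EFin \o (fun x => c * f x)).
Proof. by move=> mf; exact: (integrableZl measurableT c mf). Qed.

End integrable_EFin.

Lemma measurable_ray {R : realType} (z : R) : measurable [set y : R | z < y].
Proof. by rewrite -set_itvoy; exact: measurable_itv. Qed.

Lemma fine_le_measure {R : realType} {d0} {T : measurableType d0}
    (m : {measure set T -> \bar R}) (A B : set T) : m setT = 1%E ->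
  measurable A -> measurable B -> A `<=` B -> fine (m A) <= fine (m B).
Proof.
move=> m1 mA mB AB.
have mfin C : measurable C -> m C \is a fin_num.
  move=> mC; rewrite ge0_fin_numE//; apply: (@le_lt_trans _ _ (m setT)).
    by apply: le_measure; rewrite ?inE.
  by rewrite m1 ltry.
by apply: fine_le; rewrite ?mfin//; apply: le_measure; rewrite ?inE.
Qed.

(** Its integral is the share of the first absolute moment due to steps of size at least [K];
    integrability makes it small for large [K]. *)
Definition abs_tail {R : realType} (K y : R) : R := if K <= `|y| then `|y| else 0.

Lemma measurable_abs_tail {R : realType} (K : R) : measurable_fun setT (abs_tail K).
Proof.
apply: measurable_fun_ifT => //.
exact: measurable_fun_ler.
Qed.

Lemma integrable_abs_tail {R : realType} (m : {measure set R -> \bar R}) (K : R) :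
  m.-integrable setT EFin -> m.-integrable setT (EFin \o abs_tail K).
Proof.
move=> mi; apply: le_integrable mi => //.
  by apply/measurable_EFinP; exact: measurable_abs_tail.
by move=> x _; rewrite /= lee_fin /abs_tail; case: ifP; rewrite ?normr_id ?normr0.
Qed.

Lemma abs_tail_cvg0 {R : realType} (m : {measure set R -> \bar R}) :
  m.-integrable setT EFin ->
  (\int[m]_y abs_tail n%:R y)%R @[n --> \oo] --> 0.
Proof.
move=> mi.
have [] := @dominated_convergence _ _ R m setT measurableT
  (fun n y => (abs_tail n%:R y)%:E) (cst 0%E) (fun y => `|y|%:E).
- by move=> n; apply/measurable_EFinP; exact: measurable_abs_tail.
- exact: measurable_cst.
- apply: aeW => y _; apply: cvg_near_cst.
  near=> n; rewrite /abs_tail ifF//; apply/negbTE; rewrite -ltNge.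
  by near: n; exact: nbhs_infty_gtr.
- exact: integrable_abse mi.
- apply: aeW => y n _ /=; rewrite lee_fin /abs_tail.
  by case: ifP; rewrite ?normr_id ?normr0.
move=> _ _; rewrite integral0 => H.
exact: (@fine_cvg R _ \oo _ _ 0 H).
Unshelve. all: by end_near. Qed.

(* Probability that a walk started at 0, whose step laws are chosen adversarially
   in the family [nu], exceeds level [x] at one of the times 0, ..., n. *)
Fixpoint crossing {R : realType} {I : finType} (nu : I -> {measure set R -> \bar R})
    (n : nat) (x : R) : R :=
  if x < 0 then 1 else
  if n is n'.+1 then \big[Num.max/0]_(i : I) \int[nu i]_y crossing nu n' (x - y)
  else 0.

Section crossing.
Context {R : realType} {I : finType} {nu : I -> {measure set R -> \bar R}}.
Hypothesis nu1 : forall i, nu i setT = 1%E.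

Local Notation r := (crossing nu).

Lemma crossing_lt0 n x : x < 0 -> r n x = 1.
Proof. by case: n => [|n] /= ->. Qed.

Lemma crossing_ge0 n x : 0 <= r n x.
Proof.
elim: n x => [|n IH] x /=; first by case: ifP.
case: ifP => // _; exact: bigmax_ge_id.
Qed.

(** The two facts share one induction: comparing the integrals at stage [n.+1] requires
    integrability, which comes from boundedness and monotonicity (hence measurability) at stage
    [n]. *)
Lemma crossing_le1_noninc n : (forall x, r n x <= 1) /\ nonincreasing_fun (r n).
Proof.
elim: n => [|n [IH1 IH2]].
  split=> [x|a b ab] /=; first by case: ifP.
  have [b0|b0] := ltP b 0; last by case: ifP.
  by rewrite (le_lt_trans ab b0).
have mr (x : R) : measurable_fun setT (fun y : R => r n (x - y)).
  by apply: nondecreasing_measurable => // a b ab; apply: IH2; rewrite lerB.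
have ir i (x : R) : (nu i).-integrable setT (EFin \o (fun y : R => r n (x - y))).
  apply: (integrable_bounded _ _ 1) => // y.
  by rewrite ger0_norm ?crossing_ge0.
have le1 x : r n.+1 x <= 1.
  rewrite /=; case: ifP => // _; apply: bigmax_le => // i _.
  have -> : 1 = \int[nu i]_y cst 1 y :> R by rewrite Rintegral_cst// nu1 mulr1.
  by apply: le_Rintegral => //; apply: (integrable_bounded _ _ 1) => // y; rewrite normr1.
split=> // a b ab.
have [a0|a0] := ltP a 0; first by rewrite (crossing_lt0 _ a).
rewrite /= (ltNge a 0) (ltNge b 0) a0 (le_trans a0 ab)/=.
apply: bigmax_le => [|i _]; first exact: bigmax_ge_id.
apply: le_trans (le_bigmax _ _ i).
by apply: le_Rintegral => // y _; apply: IH2; rewrite lerB.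
Qed.

Lemma crossing_le1 n x : r n x <= 1.
Proof. by have [] := crossing_le1_noninc n. Qed.

Lemma crossing_noninc n : nonincreasing_fun (r n).
Proof. by have [] := crossing_le1_noninc n. Qed.

Lemma measurable_crossing n x : measurable_fun setT (fun y : R => r n (x - y)).
Proof.
apply: nondecreasing_measurable => // a b ab.
by apply: crossing_noninc; rewrite lerB.
Qed.

Lemma integrable_crossing i n x :
  (nu i).-integrable setT (EFin \o (fun y : R => r n (x - y))).
Proof.
apply: (integrable_bounded _ _ 1) => //; first exact: measurable_crossing.
by move=> y; rewrite ger0_norm ?crossing_ge0 ?crossing_le1.
Qed.

Lemma crossing_step i n x : 0 <= x -> \int[nu i]_y r n (x - y) <= r n.+1 x.
Proof. by move=> x0 /=; rewrite ltNge x0/=; exact: (le_bigmax _ _ i). Qed.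

Lemma crossingS_le n x c : 0 <= x -> 0 <= c ->
  (forall i, \int[nu i]_y r n (x - y) <= c) -> r n.+1 x <= c.
Proof. by move=> x0 c0 h /=; rewrite ltNge x0/=; exact: bigmax_le. Qed.

Lemma crossing_leS n x : r n x <= r n.+1 x.
Proof.
elim: n x => [|n IH] x; (have [x0|x0] := ltP x 0; first by rewrite !crossing_lt0).
  have -> : r 0 x = 0 by rewrite /= ltNge x0.
  exact: crossing_ge0.
apply: crossingS_le => // [|i]; first exact: crossing_ge0.
apply: le_trans (crossing_step i _ x x0).
by apply: le_Rintegral => //; exact: integrable_crossing.
Qed.

(* To exceed [x + a] without a jump larger than [z], the walk must first exceed
   [x], which it then does by at most [z], and then climb by a further [a - z]. *)
Lemma crossing_split n x a z F : 0 <= z -> z <= a -> - z <= x ->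
  (forall i, fine (nu i [set y | z < y]) <= F) -> 0 <= F ->
  r n (x + a) <= r n x * r n (a - z) + n%:R * F.
Proof.
move=> z0 za zx nF F0.
(* A negative start means that the first level has been overshot, by at most [z]; the distance left
   is then at least [a - z]. Admitting such starts is what lets the induction go through. *)
have neg m b : - z <= b -> b < 0 -> r m (b + a) <= r m b * r m (a - z) + m%:R * F.
  move=> zb b0; rewrite (crossing_lt0 m b b0) mul1r; apply: ler_wpDr; first by rewrite mulr_ge0.
  by apply: crossing_noninc; lra.
elim: n x zx => [|n IH] x zx.
  have [x0|x0] := ltP x 0; first exact: neg.
  by rewrite /= !ltNge x0 (addr_ge0 x0 (le_trans z0 za))/= mul0r add0r mul0r.
have [x0|x0] := ltP x 0; first exact: neg.
have mS := measurable_ray (x + z).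
apply: crossingS_le => [||i].
- by rewrite addr_ge0// (le_trans z0 za).
- by rewrite addr_ge0 ?mulr_ge0 ?crossing_ge0.
have iI : (nu i).-integrable setT (EFin \o (\1_[set y : R | x + z < y] : R -> R)).
  apply: (integrable_bounded _ _ 1) => //.
  by move=> y; rewrite indicE; case: (_ \in _); rewrite ?normr1 ?normr0.
pose A := r n (a - z).
have i1 : (nu i).-integrable setT (EFin \o (fun y : R => A * r n (x - y))).
  by apply: integrable_EFinZ; exact: integrable_crossing.
have i2 : (nu i).-integrable setT (EFin \o (fun y : R => n%:R * F + \1_[set y : R | x + z < y] y)).
  apply: integrable_EFinD => //.
  by apply: (integrable_bounded _ _ `|n%:R * F|).
(* A step up to [x + z] leads to a position above [- z], where the induction hypothesis applies. The
   indicator pays for longer steps, and its mean accounts for one more [F]. *)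
apply: (@le_trans _ _ (\int[nu i]_y (A * r n (x - y) + (n%:R * F + \1_[set y : R | x + z < y] y)))).
  apply: le_Rintegral => //; first exact: integrable_crossing.
    exact: integrable_EFinD.
  move=> y _; rewrite indicE.
  have [yxz|yxz] := leP y (x + z).
    rewrite memNset /= ?addr0; last by apply/negP; rewrite -leNgt.
    by rewrite addrAC mulrC; apply: IH; lra.
  rewrite mem_set//= ; apply: le_trans (crossing_le1 _ _) _.
  have : 0 <= n%:R * F by rewrite mulr_ge0.
  have : 0 <= A * r n (x - y) by rewrite mulr_ge0 ?crossing_ge0.
  by lra.
rewrite RintegralD// RintegralD//; last by apply: (integrable_bounded _ _ `|n%:R * F|).
rewrite RintegralZl ?Rintegral_cst ?nu1 ?mulr1//; last exact: integrable_crossing.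
have -> : \int[nu i]_y \1_[set y : R | x + z < y] y = fine (nu i [set y | x + z < y]).
  by rewrite /Rintegral integral_indic// setIT.
have c1 : A * \int[nu i]_y r n (x - y) <= r n.+1 x * r n.+1 (a - z).
  rewrite mulrC; apply: ler_pM => //; rewrite ?crossing_ge0//.
  - by apply: Rintegral_ge0 => y _; exact: crossing_ge0.
  - exact: crossing_step.
  - exact: crossing_leS.
have c2 : fine (nu i [set y | x + z < y]) <= F.
  apply: le_trans (nF i); apply: fine_le_measure => //; first exact: measurable_ray.
  by move=> y /=; apply: le_lt_trans; lra.
by rewrite -natr1; lra.
Qed.

End crossing.

(** * Heavy-tailed steps with negative mean *)

Section tail_walk.
Context {R : realType} {I : finType} (nu : I -> {measure set R -> \bar R}).
Variables (G f : R -> R) (eps : R).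
Hypothesis G_gt0 : forall x, 0 < G x.
Hypothesis G_noninc : nonincreasing_fun G.
Hypothesis G_consistent : forall eta, 0 < eta ->
  exists2 v, 1 < v & \forall x \near +oo, (1 - eta) * G x <= G (v * x).
Hypothesis f_ge0 : forall x, 0 <= f x.
Hypothesis f_lower : forall a b, a <= b -> (b - a) * G b <= f a - f b.
Hypothesis f_upper : forall a b, a <= b -> f a - f b <= (b - a) * G a.
Hypothesis f_cvg0 : f x @[x --> +oo] --> 0.
Hypothesis eps_gt0 : 0 < eps.
Hypothesis nu1 : forall i, nu i setT = 1%E.
Hypothesis nu_int : forall i, (nu i).-integrable setT EFin.
Hypothesis nu_mean : forall i, \int[nu i]_y y = - eps.
Hypothesis nu_tail : forall i delta, 0 < delta ->
  \forall x \near +oo, fine (nu i [set y | x < y]) <= delta * G x.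

Lemma f_noninc : nonincreasing_fun f.
Proof.
move=> a b ab; rewrite -subr_ge0; apply: le_trans (f_lower _ _ ab).
by rewrite mulr_ge0 ?subr_ge0// ltW.
Qed.

(** A first-order expansion of [f], whose rate of decrease near [x] is between [G (x + K)] and
    [G (x - K)]. For [|y| < K] the error is the variation of [G] on that window. For [y <= - K], [f]
    does not increase and the [abs_tail] term cancels the linear one. Steps between [K] and [x / 2]
    cost at most [G (x / 2) * y], and longer ones at most [f 0], thanks to the clipping at 0. *)
Lemma lyapunov_pointwise K x y : 0 < K -> 2 * K <= x ->
  f (Num.max 0 (x - y)) - f x <= G (x + K) * y
    + (G (x + K) + G (2^-1 * x)) * abs_tail K y
    + (G (x - K) - G (x + K)) * K + f 0 * \1_[set z | 2^-1 * x < z] y.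
Proof.
move=> K0 Kx.
have GD : G (x + K) <= G (x - K) by apply: G_noninc; lra.
have G1 := G_gt0 (x + K); have G2 := G_gt0 (2^-1 * x).
have f0 := f_ge0 0; have fx := f_ge0 x.
have i0 : 0 <= (\1_[set z | 2^-1 * x < z] y : R) by rewrite indicE.
have h0 : 0 <= f 0 * \1_[set z | 2^-1 * x < z] y by rewrite mulr_ge0.
have h1 : 0 <= (G (x - K) - G (x + K)) * K by apply: mulr_ge0; lra.
rewrite /abs_tail; case: ifPn; last first.
  rewrite -ltNge ltr_norml => /andP[y1 y2].
  rewrite (max_idPr _) ?mulr0 ?addr0; last lra.
  have [y0|y0] := leP y 0.
    have := f_lower x (x - y); have : G (x + K) <= G (x - y) by apply: G_noninc; lra.
    by move=> g1 /(_ ltac:(lra)); nra.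
  have := f_upper (x - y) x; have : G (x - y) <= G (x - K) by apply: G_noninc; lra.
  by move=> g1 /(_ ltac:(lra)); nra.
have [y0|y0 Ky] := leP y 0.
  rewrite ler0_norm// => Ky.
  have : f (Num.max 0 (x - y)) <= f x by apply: f_noninc; rewrite le_max; apply/orP; right; lra.
  nra.
rewrite gtr0_norm// in Ky *.
have [yx|yx] := leP y (2^-1 * x).
  rewrite (max_idPr _); last lra.
  have := f_upper (x - y) x; have : G (x - y) <= G (2^-1 * x) by apply: G_noninc; lra.
  by move=> g1 /(_ ltac:(lra)); nra.
have -> : \1_[set z | 2^-1 * x < z] y = 1 :> R by rewrite indicE mem_set.
have : f (Num.max 0 (x - y)) <= f 0 by apply: f_noninc; rewrite le_max lexx.
nra.
Qed.

(** After integration the linear term gives [- eps * G (x + K)], and each of the three error terms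
    is at most a quarter of this in size. [K] is fixed by integrability of the steps, before [eta],
    which depends on it. *)
Lemma lyapunov i : \forall x \near +oo,
  \int[nu i]_y f (Num.max 0 (x - y)) <= f x.
Proof.
have [D D0 GD] := consistent_dominated _ G_noninc G_consistent 2^-1 ltac:(by rewrite invr_gt0).
have [K K0 tK] : exists2 K, 0 < K & (1 + 2 * D) * \int[nu i]_y abs_tail K y <= eps / 4.
  have /cvgrPdist_le/(_ (eps / 4 / (1 + 2 * D))) := abs_tail_cvg0 _ (nu_int i).
  case; first by rewrite !divr_gt0//; lra.
  move=> n _ Hn; exists n.+1%:R; first by rewrite ltr0n.
  have /= := Hn n.+1 (leqnSn n); rewrite sub0r normrN => h.
  rewrite mulrC -ler_pdivlMr; last lra.
  exact: le_trans (ler_norm _) h.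
(* The first bound yields [G (x - K) <= 2 * G (x + K)]; with it, the second makes the variation of
   [G] times [K] at most [eps / 4 * G (x + K)]. *)
pose eta : R := Num.min 2^-1 (eps / (8 * K)).
have eta0 : 0 < eta by rewrite lt_min invr_gt0 ltr0n/= divr_gt0// mulr_gt0.
(* Chosen so that [(f 0 + 1) * delta * 2 * D = eps / 4]; the added 1 makes positivity immediate. *)
pose delta : R := eps / (8 * D * (f 0 + 1)).
have f0 := f_ge0 0.
have delta0 : 0 < delta by rewrite divr_gt0// !mulr_gt0//; lra.
have HL := consistent_long_tailed _ G_noninc G_consistent K eta eta0.
have HT := near_pinftyM _ _ (ltac:(by rewrite invr_gt0) : 0 < 2^-1 :> R) (nu_tail i delta delta0).
near=> x.
have Kx : 2 * K <= x by near: x; apply: nbhs_pinfty_ge; rewrite num_real.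
have GL : (1 - eta) * G (x - K) <= G (x + K) by near: x.
have GDx : G (2^-1 * x) <= D * G x by near: x.
have Tx : fine (nu i [set y | 2^-1 * x < y]) <= delta * G (2^-1 * x) by near: x.
have G1 : G x <= G (x - K) by apply: G_noninc; lra.
have Gp := G_gt0 (x + K).
have Gm := G_gt0 (x - K).
have e1 : eta <= 2^-1 by rewrite ge_min lexx.
have e2 : eta * K <= eps / 8.
  rewrite -ler_pdivlMr// -mulrA -invfM; by rewrite ge_min lexx orbT.
have G2 : G (x - K) <= 2 * G (x + K) by nra.
set ind := \1_[set z | 2^-1 * x < z] : R -> R.
have mS : measurable [set z : R | 2^-1 * x < z].
  by rewrite -set_itvoy; exact: measurable_itv.
have mI : (nu i).-integrable setT (EFin \o ind).
  apply: (integrable_bounded _ _ 1) => //; first exact: measurable_indic.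
  by move=> y; rewrite /ind indicE; case: (_ \in _); rewrite ?normr1 ?normr0.
have mA := integrable_abs_tail _ K (nu_int i).
have mf : (nu i).-integrable setT (EFin \o (fun y => f (Num.max 0 (x - y)))).
  apply: (integrable_bounded _ _ (f 0)) => //.
    apply: nondecreasing_measurable => // a b ab; apply: f_noninc.
    by rewrite ge_max le_max lexx/= le_max; apply/orP; right; lra.
  move=> y; rewrite ger0_norm ?f_ge0//; apply: f_noninc.
  by rewrite le_max lexx.
have mC c : (nu i).-integrable setT (EFin \o (fun=> c)).
  by apply: (integrable_bounded _ _ `|c|).
have mid : (nu i).-integrable setT (EFin \o (fun y : R => y)) by exact: nu_int.
have [c1 c1E] : exists c, c = f x + (G (x - K) - G (x + K)) * K by eexists.
have [c2 c2E] : exists c, c = G (x + K) + G (2^-1 * x) by eexists.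
apply: (@le_trans _ _ (\int[nu i]_y
    (c1 + (G (x + K) * y + (c2 * abs_tail K y + f 0 * ind y))))).
  apply: le_Rintegral => //.
    by do 3 (apply: integrable_EFinD => //; try exact: integrable_EFinZ).
  by move=> y _; have := lyapunov_pointwise K x y K0 Kx; rewrite c1E c2E -/ind; lra.
have i1 : (nu i).-integrable setT (EFin \o (fun y => c2 * abs_tail K y + f 0 * ind y)).
  by apply: integrable_EFinD; exact: integrable_EFinZ.
have i2 : (nu i).-integrable setT (EFin \o (fun y => G (x + K) * y)).
  exact: integrable_EFinZ.
rewrite RintegralD//; last exact: integrable_EFinD.
rewrite RintegralD// RintegralD//; do ?exact: integrable_EFinZ.
rewrite Rintegral_cst// nu1 mulr1 !RintegralZl// nu_mean.
have -> : \int[nu i]_y ind y = fine (nu i [set z | 2^-1 * x < z]).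
  by rewrite /Rintegral integral_indic// setIT.
set t := \int[nu i]_y _ in tK *; set q := fine _ in Tx *.
have t0 : 0 <= t.
  by apply: Rintegral_ge0 => y _; rewrite /abs_tail; case: ifP.
have G3 : G (2^-1 * x) <= 2 * D * G (x + K).
  apply: le_trans GDx _; rewrite (mulrC 2) -mulrA ler_pM2l//; lra.
have q1 : f 0 * q <= eps / 4 * G (x + K).
  have h1 : f 0 * q <= (f 0 + 1) * (delta * (2 * D * G (x + K))).
    apply: ler_pM => //; [exact: fine_ge0|lra|].
    by apply: le_trans Tx _; rewrite ler_pM2l.
  apply: le_trans h1 _; rewrite /delta le_eqVlt; apply/orP; left; apply/eqP.
  by field; rewrite gt_eqF ?gt_eqF//=; lra.
have q2 : c2 * t <= eps / 4 * G (x + K).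
  have c2le : c2 <= (1 + 2 * D) * G (x + K) by rewrite c2E; lra.
  apply: le_trans (ler_wpM2r t0 c2le) _.
  by rewrite mulrAC ler_pM2r.
have q3 : (G (x - K) - G (x + K)) * K <= eps / 4 * G (x + K).
  apply: (@le_trans _ _ (eta * K * G (x - K))); last first.
    apply: (le_trans (ler_wpM2r (ltW Gm) e2)).
    have : eps * G (x - K) <= eps * (2 * G (x + K)) by rewrite ler_pM2l.
    lra.
  by rewrite mulrAC ler_pM2r//; lra.
have e3 : 0 < eps * G (x + K) by rewrite mulr_gt0.
by rewrite c1E; lra.
Unshelve. all: by end_near. Qed.

Local Notation r := (crossing nu).

(** A maximal inequality for a supermartingale. Since [f] has the Lyapunov property only beyond some
    [x0], levels are shifted by [x0]: the ratio [f (x + x0) / f x0], clipped at 0, is at least 1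
    once the level is crossed, does not grow on average before, and tends to 0 in [x]. *)
Lemma crossing_cvg0 eta : 0 < eta ->
  \forall x \near +oo, forall n, r n x <= eta.
Proof.
move=> eta0.
have [x0 x00 Lx0] : exists2 x0, 0 <= x0 & forall x, x0 <= x ->
    forall i, \int[nu i]_y f (Num.max 0 (x - y)) <= f x.
  have [M [_ HM]] : \forall x \near +oo, forall i, \int[nu i]_y f (Num.max 0 (x - y)) <= f x.
    apply: filter_forall => i.
    exact: lyapunov.
  exists (Num.max 0 (M + 1)); first by rewrite le_max lexx.
  move=> x; rewrite ge_max => /andP[_ Mx]; apply: HM.
  by apply: lt_le_trans Mx; rewrite ltrDl.
have fni := f_noninc.
have fx0 : 0 < f x0.
  apply: (@lt_le_trans _ _ ((x0 + 1 - x0) * G (x0 + 1))).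
    by rewrite mulr_gt0// addrAC subrr add0r.
  apply: (@le_trans _ _ (f x0 - f (x0 + 1))); first by apply: f_lower; rewrite lerDl.
  by rewrite lerBlDr lerDl.
have bound n x : r n x <= f (Num.max 0 (x + x0)) / f x0.
  rewrite ler_pdivlMr//; elim: n x => [|n IH] x.
    have [x_lt0|x_ge0] := ltP x 0.
      by rewrite crossing_lt0// mul1r fni// ge_max x00/=; lra.
    by rewrite /= ltNge x_ge0/= mul0r.
  have [x_lt0|x_ge0] := ltP x 0.
    by rewrite crossing_lt0// mul1r fni// ge_max x00/=; lra.
  rewrite -ler_pdivlMr// crossingS_le// => [|i]; first by rewrite divr_ge0// ltW.
  rewrite ler_pdivlMr// mulrC -RintegralZl//; last exact: integrable_crossing.
  have -> : Num.max 0 (x + x0) = x + x0 by apply/max_idPr; rewrite addr_ge0.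
  apply: le_trans (Lx0 (x + x0) _ i); last by lra.
  apply: le_Rintegral => //.
  - by apply: integrable_EFinZ; exact: integrable_crossing.
  - apply: (integrable_bounded _ _ (f 0)) => //.
      apply: nondecreasing_measurable => // a b ab; apply: fni.
      by rewrite ge_max le_max lexx/= le_max; apply/orP; right; lra.
    move=> y; rewrite ger0_norm ?f_ge0//; apply: fni.
    by rewrite le_max lexx.
  by move=> y _; rewrite mulrC addrAC.
have : \forall x \near +oo, f x <= eta * f x0.
  have /cvgrPdist_le/(_ (eta * f x0)) := f_cvg0.
  case; first exact: mulr_gt0.
  move=> M [Mr HM]; exists M; split => // x Mx.
  by have /= := HM x Mx; rewrite sub0r normrN; apply: le_trans (ler_norm _).
move=> H; near=> x => n; apply: le_trans (bound n x) _.
rewrite ler_pdivrMr//; apply: (@le_trans _ _ (f x)); last by near: x.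
apply: fni; rewrite le_max; apply/orP; right; lra.
Unshelve. all: by end_near. Qed.

Lemma crossing_triple n u F : 0 <= u -> 0 <= F ->
  (forall i, fine (nu i [set y | u < y]) <= F) ->
  r n (3 * u) <= r n u * r n u + n%:R * F.
Proof.
move=> u0 F0 uF; have -> : 3 * u = u + 2 * u by ring.
apply: le_trans (crossing_split nu1 n u (2 * u) u F _ _ _ _ _) _ => //; try lra.
by have -> : 2 * u - u = u by ring.
Qed.

(* A crossing of level [3 u] without a jump above [u] contains two successive
   crossings of level [u], each of which is uniformly unlikely: hence the bound
   propagates from scale [u] to scale [3 u]. *)
Lemma crossing_linear : exists2 A, 0 < A &
  forall n x, 0 <= x -> r n x <= A * n.+1%:R * G x.
Proof.
have [D D0 GD'] := consistent_dominated _ G_noninc G_consistent 3^-1 ltac:(by rewrite invr_gt0).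
have GD := near_pinftyM (3 : R) _ ltac:(lra) GD'.
(* One factor of [(r n u)^2] is bounded by [(2 D)^-1], the other by induction. The loss [D] from
   [G u] to [G (3 u)] cancels, which leaves half of the target. *)
have H1 := crossing_cvg0 (2 * D)^-1 ltac:(by rewrite invr_gt0 mulr_gt0).
have H2 : \forall x \near +oo, forall i, fine (nu i [set y | x < y]) <= 1 * G x.
  by apply: filter_forall => i; exact: nu_tail.
have [M M0 HM] : exists2 M, 0 < M & forall u, M <= u -> [/\ G u <= D * G (3 * u),
    forall n, r n u <= (2 * D)^-1 & forall i, fine (nu i [set y | u < y]) <= G u].
  have [M [_ HM]] : \forall u \near +oo, [/\ G u <= D * G (3 * u),
    forall n, r n u <= (2 * D)^-1 & forall i, fine (nu i [set y | u < y]) <= G u].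
    near=> u; split.
    - have : G (3^-1 * (3 * u)) <= D * G (3 * u) by near: u.
      by rewrite mulKf.
    - by near: u.
    - move=> i; rewrite -[leRHS]mul1r.
      by have : forall i, fine (nu i [set y | u < y]) <= 1 * G u by near: u.
  exists (Num.max 1 (M + 1)); first by rewrite lt_max ltr01.
  move=> u; rewrite ge_max => /andP[_ Mu]; apply: HM.
  by apply: lt_le_trans Mu; rewrite ltrDl.
(* [2 D <= A] lets the other half of the target pay for the jumps; [(G (3 M))^-1 <= A] makes the
   target at least 1 up to level [3 M], where the induction starts. *)
pose A := Num.max (2 * D) (G (3 * M))^-1.
have A1 : 2 * D <= A by rewrite le_max lexx.
have A2 : (G (3 * M))^-1 <= A by rewrite le_max lexx orbT.
have A0 : 0 < A by apply: lt_le_trans A1; rewrite mulr_gt0.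
have base n x : x <= 3 * M -> r n x <= A * n.+1%:R * G x.
  move=> xM; apply: le_trans (crossing_le1 nu1 _ _) _.
  have : 1 <= A * G x.
    rewrite -(mulVf (lt0r_neq0 (G_gt0 (3 * M)))).
    by apply: ler_pM => //; [rewrite invr_ge0 ltW|exact: ltW|exact: G_noninc].
  have : (1 : R) <= n.+1%:R by rewrite ler1n.
  by rewrite mulrAC; nra.
exists A => // n x x0.
(* The induction is on the number of triplings needed to reach [x] from [3 M]. *)
have [k] := expr_unbounded (3 : R) (x / (3 * M)) ltac:(lra).
rewrite ler_pdivrMr ?mulr_gt0//.
elim: k x x0 => [|k IH] x x0; first by rewrite expr0 mul1r; exact: base.
move=> xk; have [|xM] := leP x (3 * M); first exact: base.
pose u := 3^-1 * x.
have xu : x = 3 * u by rewrite /u mulVKf.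
have uM : M <= u by lra.
have [Gu ru tu] := HM u uM.
have {}IH : r n u <= A * n.+1%:R * G u.
  by apply: IH; [lra|move: xk; rewrite xu exprS; lra].
rewrite xu; apply: le_trans (crossing_triple n u (G u) _ _ tu) _; [lra|exact: ltW|].
have n1 : (0 : R) <= n%:R by [].
have h1 : r n u * r n u <= A / 2 * n.+1%:R * G (3 * u).
  apply: (@le_trans _ _ ((2 * D)^-1 * (A * n.+1%:R * (D * G (3 * u))))).
    apply: ler_pM => //; rewrite ?crossing_ge0//.
    by apply: le_trans IH _; rewrite ler_pM2l// mulr_gt0.
  by rewrite le_eqVlt; apply/orP; left; apply/eqP; field; rewrite gt_eqF.
have h2 : n%:R * G u <= A / 2 * n.+1%:R * G (3 * u).
  apply: (@le_trans _ _ (n.+1%:R * (D * G (3 * u)))).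
    by apply: ler_pM => //; [exact: ltW|rewrite ler_nat].
  rewrite mulrCA mulrA; apply: ler_wpM2r; first exact: ltW.
  by apply: ler_wpM2r => //; lra.
by lra.
Unshelve. all: by end_near. Qed.

(** The tripling inequality is used once more: in the square, one factor is now arbitrarily small by
    [crossing_cvg0] and the other is linear by [crossing_linear]. *)
Lemma crossing_small delta : 0 < delta ->
  \forall x \near +oo, forall n, r n x <= delta * n.+1%:R * G x.
Proof.
move=> delta0.
have [D D0 GD] := consistent_dominated _ G_noninc G_consistent 3^-1 ltac:(by rewrite invr_gt0).
have [A A0 rA] := crossing_linear.
(* The product contributes [eta * A * D] and the jumps [eta * D], which add up to [delta]. *)
pose eta := delta / (D * (A + 1)).
have eta0 : 0 < eta by rewrite divr_gt0// mulr_gt0// addr_gt0.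
have p3 : 0 < 3^-1 :> R by rewrite invr_gt0.
have H1 := near_pinftyM _ _ p3 (crossing_cvg0 eta eta0).
have H2 : \forall x \near +oo, forall i, fine (nu i [set y | x < y]) <= eta * G x.
  by apply: filter_forall => i; exact: nu_tail.
have H3 := near_pinftyM _ _ p3 H2.
near=> x => n; pose u := 3^-1 * x.
have u0 : 0 <= u.
  by rewrite mulr_ge0//; near: x; apply: nbhs_pinfty_ge; rewrite num_real.
have Gu : G (3^-1 * x) <= D * G x by near: x.
have ru : r n u <= eta by have : forall n, r n (3^-1 * x) <= eta by near: x.
have tu : forall i, fine (nu i [set y | 3^-1 * x < y]) <= eta * G (3^-1 * x) by near: x.
have -> : x = 3 * u by rewrite /u mulVKf.
apply: le_trans (crossing_triple n u _ u0 _ tu) _; first by rewrite mulr_ge0// ltW.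
have h1 : r n u * r n u <= eta * (A * n.+1%:R * (D * G x)).
  apply: ler_pM => //; rewrite ?crossing_ge0//.
  by apply: le_trans (rA n u u0) _; rewrite ler_pM2l// mulr_gt0.
have h2 : n%:R * (eta * G u) <= n.+1%:R * (eta * (D * G x)).
  apply: ler_pM => //; [by rewrite mulr_ge0// ltW|by rewrite ler_nat|by rewrite ler_pM2l].
apply: le_trans (lerD h1 h2) _.
have -> : 3 * u = x by rewrite /u mulVKf.
rewrite le_eqVlt; apply/orP; left; apply/eqP.
by rewrite /eta; field; rewrite !gt_eqF//; lra.
Unshelve. all: by end_near. Qed.

End tail_walk.

(** * The Poisson equation *)

Section poisson.
Context {R : realType} {d : nat} (A : 'M[R]_d).
Hypothesis A_ge0 : forall i j, 0 <= A i j.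
Hypothesis A_sum : forall i, \sum_j A i j = 1.
Hypothesis A_irr : forall i j, exists n, 0 < (A ^+ n) i j.

Lemma stochastic_expr n : (forall i j, 0 <= (A ^+ n) i j) /\
  (forall i, \sum_j (A ^+ n) i j = 1).
Proof.
elim: n => [|n [IH1 IH2]].
  rewrite expr0; split=> [i j|i]; first by rewrite mxE; case: eqP.
  rewrite (bigD1 i)//= mxE eqxx big1 ?addr0// => j ji.
  by rewrite mxE eq_sym (negbTE ji).
have mE i j : (A ^+ n.+1) i j = \sum_k A i k * (A ^+ n) k j by rewrite exprS mxE.
split=> [i j|i]; first by rewrite mE sumr_ge0// => k _; rewrite mulr_ge0.
under eq_bigr do rewrite mE.
rewrite exchange_big/= -[RHS](A_sum i); apply: eq_bigr => k _.
by rewrite -mulr_sumr IH2 mulr1.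
Qed.

(** Maximum principle: at a maximum [i0], [v i0] is the average of [v] with weights [(A ^+ n) i0 k],
    so [v] attains the maximum wherever a weight is positive; irreducibility reaches every [j] for
    some [n]. *)
Lemma harmonic_const (v : 'cV[R]_d) : A *m v = v -> forall i j, v i 0 = v j 0.
Proof.
move=> Av.
have Anv n : A ^+ n *m v = v.
  elim: n => [|n IH]; first by rewrite expr0 mul1mx.
  by rewrite exprSr -mulmxA Av.
suff max_eq i0 : (forall k, v k 0 <= v i0 0) -> forall j, v j 0 = v i0 0.
  move=> i j.
  have [m _ mmax] := arg_maxP (fun k => v k 0) (erefl true : xpredT i).
  by rewrite !(max_eq m)// => k; exact: mmax.
move=> vmax j; have [n Anij] := A_irr i0 j.
have [An_ge0 An_sum] := stochastic_expr n.
have : \sum_k (A ^+ n) i0 k * (v i0 0 - v k 0) = 0.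
  under eq_bigr do rewrite mulrBr.
  rewrite sumrB -mulr_suml An_sum mul1r.
  by rewrite -[in X in X - _](Anv n) mxE subrr.
move/eqP; rewrite psumr_eq0 => [/allP/(_ j)|k _]; last first.
  by rewrite mulr_ge0// subr_ge0.
rewrite mem_index_enum => /(_ isT)/=; rewrite mulf_eq0 gt_eqF//= subr_eq0.
by move=> /eqP.
Qed.

(* Constants span the kernel of [A - 1], so its image has codimension one and is
   the whole kernel of the stationary distribution. *)
Lemma poisson_equation (p : 'rV[R]_d) (b : 'cV[R]_d) :
  p *m A = p -> p != 0 -> p *m b = 0 -> exists g : 'cV[R]_d, A *m g - g = b.
Proof.
move=> pA p0 pb.
set B := (A - 1%:M)^T.
have rkK : (\rank (kermx B) <= 1)%N.
  suff : (kermx B <= (const_mx 1 : 'rV[R]_d))%MS.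
    by move/mxrankS => /leq_trans; apply; exact: rank_leq_row.
  apply/row_subP => i; set u := row i _.
  have uB : u *m B = 0 by rewrite -row_mul mulmx_ker row0.
  have Au : A *m u^T = u^T.
    apply/eqP; rewrite -subr_eq0 -[X in _ - X]mul1mx -mulmxBl.
    by rewrite -[A - _]trmxK -/B -trmx_mul uB trmx0.
  have [j0 _|d0] := pickP (fun j : 'I_d => true); last first.
    by rewrite [u](_ : _ = 0) ?sub0mx//; apply/rowP => j; have := d0 j.
  apply/sub_rVP; exists (u 0 j0); apply/rowP => k; rewrite !mxE mulr1.
  by have := harmonic_const _ Au k j0; rewrite !mxE.
have Bp : B *m p^T = 0 by rewrite -trmx_mul mulmxBr pA mulmx1 subrr trmx0.
have Bk : (B <= kermx p^T)%MS by apply/sub_kermxP.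
have kB : (kermx p^T <= B)%MS.
  (* The kernel of [p^T] has rank [d - 1], and [B] has rank at least [d - 1] by [rkK], so the
     inclusion [Bk] is an equality. *)
  rewrite -(geq_leqif (mxrank_leqif_sup Bk)) mxrank_ker mxrank_tr rank_rV p0.
  by move: rkK; rewrite mxrank_ker leq_subLR addnC -leq_subLR.
have /submxP[g gE] : (b^T <= B)%MS.
  by apply: submx_trans kB; apply/sub_kermxP; rewrite -trmx_mul pb trmx0.
exists g^T; rewrite -[X in _ - X]mul1mx -mulmxBl -[b]trmxK gE trmx_mul.
by rewrite /B trmxK.
Qed.

End poisson.

(** * Markov additive processes *)

Lemma ge0_integral_mrestr {R : realType} {d0} {T : measurableType d0}
    (m : {measure set T -> \bar R}) (E : set T) (mE : measurable E) (f : T -> \bar R) :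
  measurable_fun setT f -> (forall x, 0 <= f x)%E ->
  (\int[mrestr m mE]_x f x = \int[m]_(x in E) f x)%E.
Proof.
move=> mf f0; have mEC := measurableC mE.
rewrite -(setUv E) ge0_integral_setU//; first last.
- by apply/disj_setPCl.
- by rewrite setUv.
rewrite [X in (_ + X)%E]null_set_integral//; last 2 first.
  exact: measurable_funTS.
  transitivity (m (~` E `&` E)) => //.
  by rewrite setICl measure0.
rewrite adde0; apply: eq_measure_integral => A mA AE.
by transitivity (m (A `&` E)) => //; rewrite setIidl.
Qed.

Lemma borel_closed_rays {R : realType} :
  @measurable _ R = <<s [set A | exists x : R, A = `]-oo, x]%classic] >>.
Proof.
apply/seteqP; split=> A.
  have -> : @measurable _ R = (@RGenOInfty.G R).-sigma.-measurable.
    exact: RGenOInfty.measurableE.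
  apply: smallest_sub => // _ [x ->].
  rewrite -setCitvl -[X in <<s _ >> X]setTD.
  apply: sigma_algebraCD.
  by apply: sub_sigma_algebra; exists x.
apply: smallest_sub; first exact: sigma_algebra_measurable.
by move=> _ [x ->]; exact: measurable_itv.
Qed.

Lemma borel_measure_unique {R : realType} (m1 m2 : {measure set R -> \bar R}) :
  (forall x, m1 `]-oo, x]%classic = m2 `]-oo, x]%classic) ->
  (forall x, m1 `]-oo, x]%classic < +oo)%E ->
  forall A, measurable A -> m1 A = m2 A.
Proof.
move=> m12 m1fin; apply: (measure_unique [set A | exists x : R, A = `]-oo, x]%classic]
    (fun n => `]-oo, n%:R]%classic)).
- exact: borel_closed_rays.
- move=> _ _ [x ->] [y ->]; exists (Num.min x y).
  by apply/seteqP; split=> z /=; rewrite !in_itv/= le_min; [move=> [-> ->]|move=> /andP[]].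
- by move=> n; exists n%:R.
- rewrite -subTset => x _; exists (Num.bound x) => //=.
  by rewrite in_itv/= ltW// unstable.ltr_bound.
- by move=> _ [x ->].
- by move=> n; exact: m1fin.
Qed.

(** Equips a bare measure of finite mass with the structure that product measures and Tonelli's
    theorem expect. *)
Lemma finite_measureP {R : realType} {d0} {T : measurableType d0}
    (m : {measure set T -> \bar R}) : (m setT < +oo)%E ->
  exists m' : {finite_measure set T -> \bar R}, forall A, m' A = m A.
Proof.
move=> mT.
have mfin : fin_num_fun m.
  move=> A mA; rewrite ge0_fin_numE//; apply: le_lt_trans mT.
  by apply: le_measure; rewrite ?inE.
pose H1 := isFinite.Build _ _ _ _ mfin.
have sf : sigma_finite setT m.
  by apply: fin_num_fun_sigma_finite => //; rewrite measure0.
pose H2 := isSFinite.Build _ _ _ _ (sfinite_measure_sigma_finite sf).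
pose H3 := isSigmaFinite.Build _ _ _ _ sf.
pose m' := HB.pack_for (FiniteMeasure.type T R) (Measure.sort m) H1 H2 H3.
by exists m'.
Qed.

(** The pi-system on which the Markov property and independence are assumed; the sigma-algebra it
    generates is the history up to time [n]. *)
Definition cylinders {R : realType} {d0 : measure_display} {Omega : measurableType d0} {d : nat}
    (X : nat -> Omega -> R) (J : nat -> Omega -> 'I_d) (n : nat) : set (set Omega) :=
  [set A | exists B C, (forall k, measurable (B k)) /\ A = cyl X J n B C].

(** * Conditioning on the history, and comparison with the adversarial walk *)

Section markov_additive.
Context {R : realType} {d0 : measure_display} {Omega : measurableType d0}.
Context {P : probability Omega R} {d : nat}.
Context {X : nat -> Omega -> R} {J : nat -> Omega -> 'I_d}.
Context {mu : 'I_d -> 'I_d -> {measure set R -> \bar R}}.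
Hypothesis mX : forall n, measurable_fun setT (X n).
Hypothesis mJ : forall n (i : 'I_d), measurable (J n @^-1` [set i]).
Hypothesis hMAP : forall (n : nat) (B : nat -> set R) (C : nat -> set 'I_d)
            (i j : 'I_d) (x : R),
      (forall k, measurable (B k)) ->
      P (cyl X J n B C `&` [set w | J n w = i]
           `&` [set w | X n.+1 w <= x /\ J n.+1 w = j])
      = (P (cyl X J n B C `&` [set w | J n w = i]) * mu i j [set` `]-oo, x]])%E.
Hypothesis hstoch : forall i, (\sum_(j < d) mu i j setT = 1)%E.

Local Notation F n := <<s cylinders X J n >>.

Lemma kernel_lty i j A : measurable A -> (mu i j A < +oo)%E.
Proof.
move=> mA; apply: (@le_lt_trans _ _ (mu i j setT)).
  by apply: le_measure; rewrite ?inE.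
apply: (@le_lt_trans _ _ 1%E); last exact: ltry.
by rewrite -(hstoch i) (bigD1 j)//= leeDl// sume_ge0.
Qed.

Lemma measurable_state n (A : set 'I_d) : measurable (J n @^-1` A).
Proof.
have -> : J n @^-1` A = \bigcup_(i in A) (J n @^-1` [set i]).
  apply/seteqP; split=> [w Aw|w [i Ai /= Ji]]; first by exists (J n w).
  by rewrite /preimage /= Ji.
by apply: fin_bigcup_measurable => // ; exact: finite_finset.
Qed.

Lemma cylinders_measurable n : cylinders X J n `<=` measurable.
Proof.
move=> _ [B [C [mB ->]]].
have -> : cyl X J n B C =
    \bigcap_(k in `I_n.+1) ((X k @^-1` B k) `&` (J k @^-1` C k)).
  by apply/seteqP; split=> w h k kn; exact: h.
apply: fin_bigcap_measurable => // k _; apply: measurableI.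
  by rewrite -[X in measurable X]setTI; exact: mX.
exact: measurable_state.
Qed.

Lemma history_measurable n : F n `<=` measurable.
Proof. apply: smallest_sub; [exact: sigma_algebra_measurable|exact: cylinders_measurable]. Qed.

Lemma cylinders_setI n : setI_closed (cylinders X J n).
Proof.
move=> _ _ [B [C [mB ->]]] [B' [C' [mB' ->]]].
exists (fun k => B k `&` B' k), (fun k => C k `&` C' k).
split=> [k|]; first exact: measurableI.
apply/seteqP; split=> [w [h h'] k kn|w h].
  by have [? ?] := h k kn; have [? ?] := h' k kn.
by split=> k kn; have [[? ?] [? ?]] := h k kn.
Qed.

Lemma cylinders_setT n : cylinders X J n setT.
Proof. by exists (fun=> setT), (fun=> setT); split=> //; apply/seteqP; split. Qed.

Lemma history_unique n (m1 m2 : {measure set Omega -> \bar R}) :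
  (m1 setT < +oo)%E -> (forall A, cylinders X J n A -> m1 A = m2 A) ->
  forall A, F n A -> m1 A = m2 A.
Proof.
move=> m1fin m12; apply: (g_sigma_algebra_measure_unique _ _ (fun=> setT)) => //.
- exact: cylinders_measurable.
- by move=> _; exact: cylinders_setT.
- by rewrite bigcup_const//; exists 0%N.
- exact: cylinders_setI.
Qed.

Lemma prob_lty A : measurable A -> (P A < +oo)%E.
Proof. by move=> mA; rewrite (le_lt_trans (probability_le1 P mA))// ltry. Qed.

(** Two uniqueness arguments: for a fixed cylinder both sides are finite measures in [B] that agree
    on rays; then, for a fixed [B], finite measures in [D] that agree on cylinders. *)
Lemma markov_history n i j D B : F n D -> measurable B ->
  P (D `&` [set w | J n w = i] `&` [set w | J n.+1 w = j] `&` (X n.+1 @^-1` B))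
    = (P (D `&` [set w | J n w = i]) * mu i j B)%E.
Proof.
move=> FD mB.
have mXB B' : measurable B' -> measurable (X n.+1 @^-1` B').
  by move=> mB'; rewrite -[X in measurable X]setTI; exact: mX.
have mJi k l : measurable [set w | J k w = l] by exact: mJ.
have cylE D' B' : cylinders X J n D' -> measurable B' ->
    P (D' `&` [set w | J n w = i] `&` [set w | J n.+1 w = j] `&` (X n.+1 @^-1` B'))
    = (P (D' `&` [set w | J n w = i]) * mu i j B')%E.
  move=> CD' mB'; have mD' := cylinders_measurable _ _ CD'.
  have mE : measurable (D' `&` [set w | J n w = i] `&` [set w | J n.+1 w = j]).
    by apply: measurableI => //; exact: measurableI.
  have [p p0 pE] : exists2 p, 0 <= p & P (D' `&` [set w | J n w = i]) = p%:E.
    exists (fine (P (D' `&` [set w | J n w = i]))); first exact: fine_ge0.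
    by rewrite fineK// ge0_fin_numE// prob_lty//; exact: measurableI.
  pose m1 := pushforward (mrestr P mE) (X n.+1).
  pose m2 := mscale (NngNum p0) (mu i j).
  rewrite pE setIC.
  apply: (@borel_measure_unique _ m1 m2 _ _ _ mB') => x.
    rewrite /m1 /m2.
    transitivity (P (D' `&` [set w | J n w = i]) * mu i j `]-oo, x]%classic)%E; last by rewrite pE.
    have [B1 [C1 [mB1 D'E]]] := CD'.
    rewrite [in RHS]D'E -hMAP// -D'E; congr (P _); apply/seteqP; split=> w /=; rewrite in_itv/=; tauto.
  apply: (@le_lt_trans _ _ (P setT)); last by rewrite probability_setT ltry.
  apply: le_measure; rewrite ?inE//.
  by apply: measurableI => //; exact: mXB.
have mEB : measurable ([set w | J n w = i] `&` [set w | J n.+1 w = j] `&` (X n.+1 @^-1` B)).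
  by apply: measurableI; [exact: measurableI|exact: mXB].
have [p p0 pE] : exists2 p, 0 <= p & mu i j B = p%:E.
  exists (fine (mu i j B)); first exact: fine_ge0.
  by rewrite fineK// ge0_fin_numE// kernel_lty.
have mEi := mJi n i.
pose m1 := mrestr P mEB; pose m2 := mscale (NngNum p0) (mrestr P mEi).
rewrite pE muleC -!setIA (setIA [set w | J n w = i]).
apply: (@history_unique n m1 m2 _ _ _ FD).
  apply: (@le_lt_trans _ _ (P setT)); last by rewrite probability_setT ltry.
  by apply: le_measure; rewrite ?inE//; exact: measurableI.
move=> A CA; rewrite /m1 /m2.
transitivity (mu i j B * P (A `&` [set w | J n w = i]))%E; last by rewrite pE.
rewrite muleC -cylE//; congr (P _).
by rewrite !setIA.
Qed.

(** Freezing: on [D] with [J n = i] and [J n.+1 = j], the joint law of [V] and [X n.+1] is the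
    product of the law of [V] on [D] with [J n = i] and of [mu i j]. Tonelli's theorem then
    integrates the new step with [V] held fixed. *)
Lemma markov_integral n i j (D : set Omega) (V : Omega -> R) (f : R * R -> \bar R) :
  F n D -> (forall B, measurable B -> F n (V @^-1` B)) ->
  measurable_fun setT f -> (forall z, 0 <= f z)%E ->
  measurable_fun setT (fun v => \int[mu i j]_y f (v, y))%E /\
  (\int[P]_(w in D `&` [set w | J n w = i] `&` [set w | J n.+1 w = j])
      f (V w, X n.+1 w) =
    \int[P]_(w in D `&` [set w | J n w = i]) \int[mu i j]_y f (V w, y))%E.
Proof.
move=> FD FV mf f0.
have [m2 m2A] := finite_measureP (mu i j) (kernel_lty i j _ measurableT).
have mJi k l : measurable [set w | J k w = l] by exact: mJ.
have mD := history_measurable _ _ FD.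
have mV : measurable_fun setT V.
  by move=> _ B mB; rewrite setTI; apply: history_measurable (FV B mB).
have mEi : measurable (D `&` [set w | J n w = i]) by exact: measurableI.
have mE : measurable (D `&` [set w | J n w = i] `&` [set w | J n.+1 w = j]).
  exact: measurableI.
have mVX : measurable_fun setT (fun w => (V w, X n.+1 w)) by exact: measurable_fun_pair.
have mP E (mE' : measurable E) : (mrestr P mE' setT < +oo)%E.
  by rewrite /mrestr setTI prob_lty.
have [m1 m1A] := finite_measureP (pushforward (mrestr P mEi) V) (mP _ mEi).
pose m12 := pushforward (mrestr P mE) (fun w => (V w, X n.+1 w)).
have prodE A : measurable A -> (m1 \x m2)%E A = m12 A.
  apply: product_measure_unique => B1 B2 mB1 mB2.
  transitivity (pushforward (mrestr P mEi) V B1 * mu i j B2)%E; last by rewrite -(m1A B1) -(m2A B2).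
  transitivity (P ((D `&` V @^-1` B1) `&` [set w | J n w = i] `&`
      [set w | J n.+1 w = j] `&` (X n.+1 @^-1` B2))).
    by congr (P _); apply/seteqP; split=> w /=; tauto.
  rewrite markov_history//; last first.
    exact: (@measurableI _ (g_sigma_algebraType (cylinders X J n)) _ _ FD (FV _ mB1)).
  congr (P _ * _)%E; apply/seteqP; split=> w /=; tauto.
have mK : measurable_fun setT (fun v => \int[mu i j]_y f (v, y))%E.
  rewrite (_ : (fun v => _) = fubini_F m2 f); first exact: measurable_fun_fubini_tonelli_F.
  by apply/funext => v; apply: eq_measure_integral => A _ _; exact: (esym (m2A A)).
split=> //.
transitivity (\int[mrestr P mE]_w f (V w, X n.+1 w))%E.
  by rewrite ge0_integral_mrestr//; exact: (measurableT_comp mf mVX).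
transitivity (\int[m12]_z f z)%E.
  by rewrite ge0_integral_pushforward.
transitivity (\int[m1 \x m2]_z f z)%E.
  by apply: eq_measure_integral => A mA _; exact: (esym (prodE A mA)).
transitivity (\int[m1]_v \int[m2]_y f (v, y))%E; first exact: fubini_tonelli1.
transitivity (\int[m1]_v \int[mu i j]_y f (v, y))%E.
  by apply: eq_integral => v _; apply: eq_measure_integral => A _ _; exact: m2A.
transitivity (\int[pushforward (mrestr P mEi) V]_v \int[mu i j]_y f (v, y))%E.
  by apply: eq_measure_integral => A _ _; exact: m1A.
rewrite ge0_integral_pushforward//; last by move=> v _; exact: integral_ge0.
rewrite ge0_integral_mrestr//; first exact: (measurableT_comp mK mV).
by move=> w; exact: integral_ge0.
Qed.

Lemma history_X n k B : (k <= n)%N -> measurable B -> F n (X k @^-1` B).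
Proof.
move=> kn mB; apply: sub_sigma_algebra.
exists (fun l => if l == k then B else setT), (fun=> setT); split.
  by move=> l; case: ifP.
apply/seteqP; split=> [w Bw l _|w /(_ k kn)[]]; last by rewrite eqxx.
by split=> //; case: eqP => [->|].
Qed.

Lemma history_J n k (A : set 'I_d) : (k <= n)%N -> F n (J k @^-1` A).
Proof.
move=> kn; apply: sub_sigma_algebra.
exists (fun=> setT), (fun l => if l == k then A else setT); split=> //.
apply/seteqP; split=> [w Bw l _|w /(_ k kn)[_]]; last by rewrite eqxx.
by split=> //; case: eqP => [->|].
Qed.

Lemma ge0_integral_state n (D : set Omega) (f : Omega -> \bar R) :
  measurable D -> measurable_fun setT f -> (forall w, 0 <= f w)%E ->
  (\int[P]_(w in D) f w =
   \sum_(i < d) \int[P]_(w in D `&` [set w | J n w = i]) f w)%E.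
Proof.
move=> mD mf f0.
have DE : D = \big[setU/set0]_(i <- index_enum 'I_d) (D `&` [set w | J n w = i]).
  apply/seteqP; split=> w; rewrite -bigcup_seq.
    by move=> Dw; exists (J n w) => //=; rewrite mem_index_enum.
  by move=> [i _ []].
rewrite {1}DE ge0_integral_bigsetU//=.
- by move=> i; apply: measurableI => //; exact: mJ.
- exact: index_enum_uniq.
- by move=> i j _ _ [w [[_ /= <-] [_ /= <-]]].
- exact: measurable_funTS.
Qed.

Context {xi : 'I_d -> 'I_d -> R -> R} {nu : 'I_d -> {measure set R -> \bar R}}.
Hypothesis mxi : forall i j, measurable_fun setT (xi i j).
Hypothesis nu1 : forall i, nu i setT = 1%E.
Hypothesis nuE : forall i (f : R -> R), measurable_fun setT f -> (forall y, 0 <= f y) ->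
  (\int[nu i]_y (f y)%:E = \sum_(j < d) \int[mu i j]_y (f (xi i j y))%:E)%E.

(** [xi i j] modifies a step made on a transition from [i] to [j], and by [nuE] the law of the
    modified step out of [i] is [nu i]. [X 0] is left out, so the walk starts at 0. *)
Definition walk (k : nat) (w : Omega) : R :=
  \sum_(l < k) xi (J l w) (J l.+1 w) (X l.+1 w).

Lemma history_walk n k B : (k <= n)%N -> measurable B -> F n (walk k @^-1` B).
Proof.
move=> kn mB.
suff mW : measurable_fun (setT : set (g_sigma_algebraType (cylinders X J n))) (walk k).
  by have := mW measurableT B mB; rewrite setTI.
(* The transformation [xi] depends on random states; expanding over all pairs of states leaves fixed
   measurable functions times indicators. *)
have -> : walk k = (fun w => \sum_(l < k) \sum_i \sum_j
    \1_[set w | J l w = i] w * (\1_[set w | J l.+1 w = j] w * xi i j (X l.+1 w))).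
  apply/funext => w; apply: eq_bigr => l _.
  rewrite (bigD1 (J l w))//= [X in _ + X]big1 ?addr0; last first.
    move=> i iJ; rewrite big1// => j _.
    by rewrite indicE memNset ?mul0r//= => iE; rewrite iE eqxx in iJ.
  rewrite (bigD1 (J l.+1 w))//= [X in _ + X]big1 ?addr0; last first.
    move=> i iJ; rewrite [X in _ * (X * _)]indicE memNset ?mul0r ?mulr0//= => iE.
    by rewrite iE eqxx in iJ.
  by rewrite !indicE !mem_set// !mul1r.
apply: measurable_sum => l; apply: measurable_sum => i; apply: measurable_sum => j.
have lk : (l.+1 <= n)%N by exact: leq_trans (ltn_ord l) kn.
apply: measurable_funM.
  by apply: measurable_indic; apply: (history_J _ _ [set i]); exact: ltnW.
apply: measurable_funM.
  by apply: measurable_indic; exact: (history_J _ _ [set j]).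
apply: (measurableT_comp (mxi i j)) => _ B' mB'; rewrite setTI.
exact: history_X.
Qed.

Lemma measurable_walk k : measurable_fun setT (walk k).
Proof.
move=> _ B mB; rewrite setTI.
exact: history_measurable (history_walk k k B (leqnn k) mB).
Qed.

Lemma measurable_walk_gt m n (x : R) :
  measurable [set w | exists k, (m <= k <= m + n)%N /\ x < walk k w].
Proof.
rewrite (_ : [set w | _] = \bigcup_(k in [set k | (m <= k <= m + n)%N])
    (walk k @^-1` [set y | x < y])); last first.
  by apply/seteqP; split=> w; [move=> [k [? ?]]; exists k|move=> [k ? ?]; exists k].
apply: bigcup_measurable => k _; rewrite -[X in measurable X]setTI.
by apply: measurable_walk => //; exact: measurable_ray.
Qed.

(** Dynamic programming: an adversary who picks the law of each step does at least as well as the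
    chain. The induction on the remaining time keeps [m] and [D] free, and integrals over events [D]
    of the history stand for conditional probabilities. *)
Lemma walk_crossing n m (x : R) (D : set Omega) : F m D ->
  (P (D `&` [set w | exists k, (m <= k <= m + n)%N /\ (x < walk k w)%R]) <=
   \int[P]_(w in D) (crossing nu n (x - walk m w))%:E)%E.
Proof.
move: n m D; pose Cr m k := [set w | exists l, (m <= l <= m + k)%N /\ x < walk l w].
have mcr k l : measurable_fun setT (fun w => (crossing nu k (x - walk l w))%:E).
  apply/measurable_EFinP.
  exact: (measurableT_comp (measurable_crossing nu1 k x) (measurable_walk l)).
have cr0 k y : (0 <= (crossing nu k y)%:E)%E by rewrite lee_fin crossing_ge0.
have Fle k l (A : set Omega) : (k <= l)%N -> F k A -> F l A.
  move=> kl; apply: smallest_sub; first exact: smallest_sigma_algebra.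
  move=> _ [B [C [mB ->]]]; apply: sub_sigma_algebra.
  exists (fun i => if (i <= k)%N then B i else setT), (fun i => if (i <= k)%N then C i else setT).
  split=> [i|]; first by case: ifP.
  apply/seteqP; split=> w h i il.
    by case: ifPn => // ik; exact: h.
  by have := h i (leq_trans il kl); rewrite il.
have mray : measurable [set y : R | y <= x].
  by rewrite -set_itvNyc; exact: measurable_itv.
have FI k A A' : F k A -> F k A' -> F k (A `&` A').
  exact: (@measurableI _ (g_sigma_algebraType (cylinders X J k))).
have FD2 m D : F m D -> F m (D `&` (walk m @^-1` [set y | y <= x])).
  by move=> FD; apply: FI => //; exact: history_walk.
(* Where the walk is above [x] at time [m], [crossing] equals 1 and nothing is to be shown; only the
   rest of [D] matters. *)
have reduce k m D : F m D ->
    (P (D `&` (walk m @^-1` [set y | (y <= x)%R]) `&` Cr m k) <=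
      \int[P]_(w in D `&` (walk m @^-1` [set y | (y <= x)%R]))
         (crossing nu k (x - walk m w))%:E)%E ->
    (P (D `&` Cr m k) <= \int[P]_(w in D) (crossing nu k (x - walk m w))%:E)%E.
  move=> FD H.
  set D2 := D `&` (walk m @^-1` [set y | y <= x]) in H.
  pose D1 := D `&` (walk m @^-1` [set y | x < y]).
  have mD1 : measurable D1.
    apply: (history_measurable m); apply: FI => //.
    by apply: history_walk => //; exact: measurable_ray.
  have mD2 : measurable D2 by apply: (history_measurable m); exact: FD2.
  have D12 : D = D1 `|` D2.
    rewrite -setIUr -preimage_setU -[LHS]setIT; congr (_ `&` _).
    by apply/seteqP; split=> // w _ /=; case: (ltP x (walk m w)); [left|right].
  rewrite [in leRHS]D12 ge0_integral_setU//=; last 2 first.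
  - exact: measurable_funTS.
  - by apply/disj_setPS => w [[_ /= xw] [_ /= wx]]; move: wx; rewrite leNgt xw.
  apply: le_trans (leeD (lexx _) H).
  apply: (@le_trans _ _ (P D1 + P (D2 `&` Cr m k))%E); last first.
    rewrite leeD// (_ : P D1 = \int[P]_(w in D1) 1%:E)%E; last first.
      by rewrite integral_cst// mul1e.
    apply: ge0_le_integral => //; first exact: measurable_funTS.
    by move=> w [_ /= xw]; rewrite crossing_lt0// subr_lt0.
  apply: (@le_trans _ _ (P (D1 `|` (D2 `&` Cr m k)))); last first.
    by apply: measureU2 => //; apply: measurableI => //; exact: measurable_walk_gt.
  have mDC : measurable (D2 `&` Cr m k).
    by apply: measurableI => //; exact: measurable_walk_gt.
  apply: le_measure; rewrite ?inE.
  - rewrite D12; apply: measurableI; first exact: measurableU.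
    exact: measurable_walk_gt.
  - exact: measurableU.
  - by rewrite D12 setIUl; apply: setSU; exact: subIsetl.
elim=> [|n IH] m D FD; apply: reduce => //;
  move: (FD2 m D FD); set D2 := D `&` _ => {}FD2;
  have mD2 := history_measurable _ _ FD2.
  rewrite (_ : D2 `&` Cr m 0%N = set0) ?measure0; first by apply: integral_ge0 => w _.
  rewrite -subset0 => w [[_ /= wx] [k [/andP[mk km] xk]]].
  have km' : k = m by apply/eqP; rewrite eqn_leq mk andbT -[leqRHS]addn0.
  by move: xk; rewrite km' ltNge wx.
(* On [D2] the level is not exceeded at time [m], so a crossing takes place at time [m.+1] or
   later. *)
apply: (@le_trans _ _ (\int[P]_(w in D2) (crossing nu n (x - walk m.+1 w))%:E)%E).
  apply: le_trans (IH m.+1 D2 (Fle _ _ _ (leqnSn m) FD2)).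
  apply: le_measure; rewrite ?inE; try by apply: measurableI => //; exact: measurable_walk_gt.
  move=> w [D2w [k [/andP[mk km] xk]]]; split=> //; exists k; split=> //.
  rewrite addSnnS km andbT ltn_neqAle mk andbT; apply/eqP => mk'.
  by move: xk; rewrite -mk' ltNge D2w.2.
(* Fixing [J m = i] and [J m.+1 = j] isolates the kernel [mu i j]; summing over [j] rebuilds
   [nu i]. *)
rewrite (ge0_integral_state m D2)// [leRHS](ge0_integral_state m D2)//.
apply: lee_sum => i _.
have mJi k l : measurable [set w | J k w = l] by exact: mJ.
have mD2i : measurable (D2 `&` [set w | J m w = i]) by exact: measurableI.
rewrite (ge0_integral_state m.+1 _)//.
pose K j (z : R * R) := ((crossing nu n (x - (z.1 + xi i j z.2)))%:E).
have mK j : measurable_fun setT (K j).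
  apply/measurable_EFinP.
  apply: (measurableT_comp (measurable_crossing nu1 n x)).
  apply: measurable_funD; first exact: measurable_fst.
  exact: (measurableT_comp (mxi i j) measurable_snd).
have FV B : measurable B -> F m (walk m @^-1` B) by exact: history_walk.
have HK j := markov_integral m i j D2 (walk m) (K j) FD2 FV (mK j)
  (fun z => cr0 n _).
rewrite (eq_bigr (fun j => \int[P]_(w in D2 `&` [set w | J m w = i]) \int[mu i j]_y K j (walk m w, y)))%E; last first.
  move=> j _; rewrite -(HK j).2; apply: eq_integral => w.
  rewrite inE => -[[_ /= Jm] /= Jm1]; by rewrite /K /walk big_ord_recr/= Jm Jm1.
rewrite -ge0_integral_sum//; last 2 first.
- move=> j; apply: measurable_funTS.
  exact: (measurableT_comp (HK j).1 (measurable_walk m)).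
- by move=> j w _; apply: integral_ge0 => y _; exact: cr0.
apply: ge0_le_integral => //.
- by move=> w _; apply: sume_ge0 => j _; apply: integral_ge0 => y _; exact: cr0.
- apply: emeasurable_sum => j; apply: measurable_funTS.
  exact: (measurableT_comp (HK j).1 (measurable_walk m)).
- exact: measurable_funTS.
move=> w [[_ /= wx] _].
have step := crossing_step i n (x - walk m w) (ltac:(by rewrite subr_ge0)).
apply: (@le_trans _ _ (\int[nu i]_y crossing nu n (x - walk m w - y))%:E); last by rewrite lee_fin.
rewrite /Rintegral fineK; last first.
  by apply: integrable_fin_num => //; exact: integrable_crossing.
rewrite nuE; last 2 first.
- exact: measurable_crossing.
- by move=> y; exact: crossing_ge0.
rewrite le_eqVlt; apply/orP; left; apply/eqP; apply: eq_bigr => j _.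
by apply: eq_integral => y _; rewrite /K/= opprD addrA.
Qed.

End markov_additive.

(** * The tail of the random time *)

Section heavy_tail.
Context {R : realType} {d0 : measure_display} {Omega : measurableType d0}.
Context {P : probability Omega R} {T : Omega -> R}.
Hypothesis mT : measurable_fun setT T.
Hypothesis hC : classC P T.
Hypothesis hET : (\int[P]_w (T w)%:E < +oo)%E.

Local Notation G := (tailP P T).

Lemma measurable_tail x : measurable [set w | x < T w].
Proof.
rewrite -[X in measurable X]setTI.
exact: (mT measurableT _ (measurable_ray x)).
Qed.

Lemma tailPE x : P [set w | x < T w] = (G x)%:E.
Proof.
rewrite /tailP fineK// ge0_fin_numE//.
by rewrite (le_lt_trans (probability_le1 _ (measurable_tail x)))// ltry.
Qed.

Lemma tailP_noninc : nonincreasing_fun G.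
Proof.
move=> a b ab; apply: fine_le_measure.
- exact: probability_setT.
- exact: measurable_tail.
- exact: measurable_tail.
- by move=> w /=; exact: le_lt_trans.
Qed.

Lemma tailP_gt0 x : 0 < G x.
Proof.
apply: (@lt_le_trans _ _ (G (Num.max 0 x))).
  rewrite -lte_fin -tailPE; apply: hC.2.1.
  by rewrite le_max lexx.
by apply: tailP_noninc; rewrite le_max lexx orbT.
Qed.

(** Some [v > 1] has a lower limit above [1 - eta]; being a supremum of infima over half-lines, it
    provides a threshold [M] beyond which the ratio stays above [1 - eta]. *)
Lemma tailP_consistent eta : 0 < eta ->
  exists2 v, 1 < v & \forall x \near +oo, (1 - eta) * G x <= G (v * x).
Proof.
move=> eta0; have [_ [_ hlim]] := hC.
have near_lim : \forall v \near 1^'+,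
    ((1 - eta)%:E < liminf_pinfty (fun x => G (v * x) / G x)%R)%E.
  apply: (hlim [set z | ((1 - eta)%:E < z)%E]).
  apply: open_nbhs_nbhs; split; first exact: open_ereal_gt_ereal.
  by rewrite /= lte_fin ltrBlDr ltrDl.
near (1 : R)^'+ => v.
exists v; first by near: v; exact: nbhs_right_gt.
have : ((1 - eta)%:E < liminf_pinfty (fun x => G (v * x) / G x)%R)%E by near: v.
move=> /ereal_sup_gt[_ [M _ <-]] HM.
exists M; split; first exact: num_real.
move=> x Mx; rewrite -ler_pdivlMr ?tailP_gt0// -lee_fin.
apply/ltW/(lt_le_trans HM)/ereal_inf_lbound.
by exists x => //=; rewrite in_itv/= andbT.
Unshelve. all: by end_near. Qed.

(** The integrated tail of [T], which plays the role of [f]. Written as an expectation, its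
    increments can be compared with [G] pointwise in [T]. *)
Definition excess x := \int[P]_w (Num.max 0 (T w - x)).

Lemma measurable_excess x : measurable_fun setT (fun w => Num.max 0 (T w - x)).
Proof. by apply: measurable_maxr => //; apply: measurable_funB. Qed.

Lemma integrable_time : P.-integrable setT (EFin \o T).
Proof.
apply/integrableP; split; first exact/measurable_EFinP.
by under eq_integral => w _ do rewrite /= ger0_norm ?hC.1//.
Qed.

Lemma integrable_excess x : P.-integrable setT (EFin \o (fun w => Num.max 0 (T w - x))).
Proof.
have ic : P.-integrable setT (EFin \o (fun w => T w + `|x|)).
  apply: integrable_EFinD; first exact: integrable_time.
  by apply: (integrable_bounded _ _ `|x|) => //; [exact: probability_setT|move=> _; rewrite normr_id].
apply: le_integrable ic => //; first by apply/measurable_EFinP; exact: measurable_excess.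
move=> w _ /=; have T0 := hC.1 w; have Tx0 : 0 <= T w + `|x| by rewrite addr_ge0.
rewrite lee_fin (ger0_norm Tx0) ger0_norm ?le_max ?lexx//.
by rewrite ge_max Tx0/= lerD2l -normrN ler_norm.
Qed.

Lemma integrable_tail x : P.-integrable setT (EFin \o (\1_[set w | x < T w] : Omega -> R)).
Proof.
apply: (integrable_bounded _ _ 1); first exact: probability_setT.
  exact/measurable_indic/measurable_tail.
by move=> w; rewrite indicE; case: (_ \in _); rewrite ?normr1 ?normr0.
Qed.

Lemma Rintegral_tail x : \int[P]_w \1_[set w | x < T w] w = G x.
Proof. by rewrite /Rintegral integral_indic// ?setIT//; exact: measurable_tail. Qed.

Lemma excess_ge0 x : 0 <= excess x.
Proof. by apply: Rintegral_ge0 => w _; rewrite le_max lexx. Qed.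

(** [(T - a)^+ - (T - b)^+] is at least [b - a] times the indicator of [b < T]; for the upper bound
    it is at most [b - a] times that of [a < T]. *)
Lemma excess_lower a b : a <= b -> (b - a) * G b <= excess a - excess b.
Proof.
move=> ab; rewrite -Rintegral_tail -RintegralZl//; last exact: integrable_tail.
rewrite -RintegralB//; [|exact: integrable_excess|exact: integrable_excess].
apply: le_Rintegral => //.
- exact: integrable_EFinZ (integrable_tail b).
- exact: (integrableB measurableT (integrable_excess a) (integrable_excess b)).
move=> w _; rewrite indicE; have [bT|Tb] := ltP b (T w).
  by rewrite mem_set//= mulr1 !(max_idPr _); lra.
rewrite memNset /=; last by apply/negP; rewrite -leNgt.
by rewrite mulr0 [Num.max 0 (T w - b)](max_idPl _) ?subr0 ?le_max ?lexx//; lra.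
Qed.

Lemma excess_upper a b : a <= b -> excess a - excess b <= (b - a) * G a.
Proof.
move=> ab; rewrite -Rintegral_tail -RintegralZl//; last exact: integrable_tail.
rewrite -RintegralB//; [|exact: integrable_excess|exact: integrable_excess].
apply: le_Rintegral => //.
- exact: (integrableB measurableT (integrable_excess a) (integrable_excess b)).
- exact: integrable_EFinZ (integrable_tail a).
move=> w _; rewrite indicE; have [aT|Ta] := ltP a (T w).
  rewrite mem_set//= mulr1 [Num.max 0 (T w - a)](max_idPr _); last lra.
  have : T w - b <= Num.max 0 (T w - b) by rewrite le_max lexx orbT.
  lra.
rewrite memNset /=; last by apply/negP; rewrite -leNgt.
by rewrite mulr0 !(max_idPl _) ?subr0//; lra.
Qed.

Lemma excess_cvg0 : excess x @[x --> +oo] --> 0.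
Proof.
have exn : excess n%:R @[n --> \oo] --> 0.
  have [] := @dominated_convergence _ _ R P setT measurableT
    (fun n w => (Num.max 0 (T w - n%:R))%:E) (cst 0%E) (fun w => (T w)%:E).
  - by move=> n; apply/measurable_EFinP; exact: measurable_excess.
  - exact: measurable_cst.
  - apply: aeW => w _; apply: cvg_near_cst.
    near=> n; congr EFin; apply/max_idPl; rewrite subr_le0.
    by near: n; exact: nbhs_infty_ger.
  - exact: integrable_time.
  - apply: aeW => w n _ /=; have T0 := hC.1 w.
    rewrite lee_fin ger0_norm ?le_max ?lexx// ge_max T0/=.
    by rewrite lerBlDr lerDl.
  move=> _ _; rewrite integral0 => H.
  exact: (@fine_cvg R _ \oo _ _ 0 H).
apply/cvgrPdist_le => e e0.
have /cvgrPdist_le/(_ e e0)[n _ Hn] := exn.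
near=> x; have := Hn n (leqnn n); rewrite /= !sub0r !normrN.
rewrite !ger0_norm ?excess_ge0//; apply: le_trans.
have nx : n%:R <= x by near: x; apply: nbhs_pinfty_ge; rewrite num_real.
rewrite -subr_ge0; apply: le_trans (excess_lower _ _ nx).
by rewrite mulr_ge0 ?subr_ge0// ltW// tailP_gt0.
Unshelve. all: by end_near. Qed.

End heavy_tail.

(** * Deviations of the partial sums *)

Lemma pushforwardP {R : realType} (m : {measure set R -> \bar R}) (f : R -> R) :
  measurable_fun setT f ->
  exists m' : {measure set R -> \bar R}, forall A, m' A = m (f @^-1` A).
Proof.
move=> mf; pose m' : {measure set R -> \bar R} := pushforward m f.
by exists (m' mf).
Qed.

(** Applied to a row [mu i], this builds the law of the modified step out of state [i], the next
    state being summed out. *)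
Lemma mixtureP {R : realType} {d : nat} (m : 'I_d -> {measure set R -> \bar R})
    (xi : 'I_d -> R -> R) : (forall j, measurable_fun setT (xi j)) ->
  exists nu : {measure set R -> \bar R},
    (forall A, nu A = \sum_(j < d) m j (xi j @^-1` A))%E /\
    (forall f : R -> \bar R, measurable_fun setT f -> (forall y, 0 <= f y)%E ->
      \int[nu]_y f y = \sum_(j < d) \int[m j]_y f (xi j y))%E.
Proof.
(* [msum] is indexed by natural numbers; the reindexing by [inord] needs a nonempty set of
   states. *)
case: d m xi => [m xi _|d m xi mxi].
  exists mzero; split=> [A|f mf f0]; first by rewrite big_ord0.
  by rewrite big_ord0 integral_measure_zero.
have [m' m'E] := choice (fun k : nat => pushforwardP (m (inord k)) _ (mxi (inord k))).
exists (msum m' d.+1); split=> [A|f mf f0].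
  by rewrite /= /msum; apply: eq_bigr => j _; rewrite m'E inord_val.
rewrite ge0_integral_measure_sum//; apply: eq_bigr => j _.
pose p : {measure set R -> \bar R} := pushforward (m j) (xi j).
transitivity (\int[p (mxi j)]_y f y)%E.
  by apply: eq_measure_integral => A _ _; rewrite m'E inord_val.
by rewrite ge0_integral_pushforward.
Qed.

Section mixture_mean.
Context {R : realType} {d : nat} (m : 'I_d -> {measure set R -> \bar R}).
Variables (xi : 'I_d -> R -> R) (nu : {measure set R -> \bar R}).
Hypothesis xi_int : forall j, (m j).-integrable setT (EFin \o xi j).
Hypothesis nuE : forall f : R -> \bar R, measurable_fun setT f -> (forall y, 0 <= f y)%E ->
      (\int[nu]_y f y = \sum_(j < d) \int[m j]_y f (xi j y))%E.

Lemma mixture_integrable : nu.-integrable setT EFin.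
Proof.
apply/integrableP; split; first exact: EFin_measurable.
rewrite nuE//; last by apply: measurableT_comp => //; exact: EFin_measurable.
by apply: lte_sum_pinfty => j _; have /integrableP[] := xi_int j.
Qed.

Lemma mixture_mean : \int[nu]_y y = \sum_(j < d) \int[m j]_y xi j y.
Proof.
have mE : measurable_fun setT (EFin : R -> \bar R) by exact: EFin_measurable.
have posE j : (EFin \o xi j)^\+%E = (fun y => EFin^\+%E (xi j y)) by rewrite funepos_comp.
have negE j : (EFin \o xi j)^\-%E = (fun y => EFin^\-%E (xi j y)) by rewrite funeneg_comp.
have pos_fin j : (\int[m j]_y (EFin^\+ (xi j y)) \is a fin_num)%E.
  by apply: integrable_fin_num => //; rewrite -posE; exact: integrable_funepos.
have neg_fin j : (\int[m j]_y (EFin^\- (xi j y)) \is a fin_num)%E.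
  by apply: integrable_fin_num => //; rewrite -negE; exact: integrable_funeneg.
rewrite /Rintegral integralE nuE; [|exact: measurable_funepos|by []].
rewrite nuE; [|exact: measurable_funeneg|by []].
have mixB (F1 F2 : 'I_d -> \bar R) : (forall j, F1 j \is a fin_num) ->
    (forall j, F2 j \is a fin_num) ->
    fine (\sum_j F1 j - \sum_j F2 j)%E = \sum_j fine (F1 j - F2 j)%E.
  move=> F1fin F2fin; rewrite -!EFin_sum_fine// -EFinB/= -sumrB.
  by apply: eq_bigr => j _; rewrite fineB.
rewrite mixB; [|exact: pos_fin|exact: neg_fin].
apply: eq_bigr => j _; congr fine.
by rewrite [RHS]integralE posE negE.
Qed.

End mixture_mean.

Section deviation_event.
Context {R : realType} {d0 : measure_display} {Omega : measurableType d0}.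
Context {d : nat} {X : nat -> Omega -> R} {J : nat -> Omega -> 'I_d}.
Variable h : R.

(** The sign [s] is 1 for excursions above the line of slope [h] and -1 for those below; [eps] tilts
    the line to create a negative drift. *)
Definition deviation (s eps : R) (n : nat) (x : R) : set Omega :=
  [set w | exists k, (k <= n)%N /\
    x < s * (Ssum X k w - X 0%N w - k%:R * h) - k%:R * eps].

Lemma history_Ssum n k : (k <= n)%N ->
  measurable_fun (setT : set (g_sigma_algebraType (cylinders X J n))) (Ssum X k).
Proof.
move=> kn; rewrite /Ssum; under eq_fun do rewrite big_mkord.
apply: measurable_sum => l _ B mB; rewrite setTI; apply: history_X => //.
by rewrite (leq_trans _ kn)// -ltnS.
Qed.

Lemma history_deviation s eps n x : <<s cylinders X J n >> (deviation s eps n x).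
Proof.
pose dev k w : R := s * (Ssum X k w - X 0%N w - k%:R * h) - k%:R * eps.
have -> : deviation s eps n x = \bigcup_(k in [set k | (k <= n)%N]) (dev k @^-1` [set y | x < y]).
  by apply/seteqP; split=> w; [move=> [k [? ?]]; exists k|move=> [k ? ?]; exists k].
apply: (@bigcup_measurable _ (g_sigma_algebraType (cylinders X J n))) => k kn.
have mdev : measurable_fun (setT : set (g_sigma_algebraType (cylinders X J n))) (dev k).
  apply: measurable_funB => //; apply: measurable_funM => //.
  apply: measurable_funB => //; apply: measurable_funB; first exact: history_Ssum.
  by move=> _ B mB; rewrite setTI; exact: history_X.
by have := mdev measurableT _ (measurable_ray x); rewrite setTI.
Qed.

End deviation_event.

Section deviation.
Context {R : realType} {d0 : measure_display} {Omega : measurableType d0}.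
Context {P : probability Omega R} {d : nat}.
Context {X : nat -> Omega -> R} {J : nat -> Omega -> 'I_d}.
Context {mu : 'I_d -> 'I_d -> {measure set R -> \bar R}}.
Context {varpi : 'rV[R]_d} {T : Omega -> R}.
Hypothesis mX : forall n, measurable_fun setT (X n).
Hypothesis mJ : forall n (i : 'I_d), measurable (J n @^-1` [set i]).
Hypothesis mT : measurable_fun setT T.
Hypothesis hMAP : forall (n : nat) (B : nat -> set R) (C : nat -> set 'I_d)
            (i j : 'I_d) (x : R),
      (forall k, measurable (B k)) ->
      P (cyl X J n B C `&` [set w | J n w = i]
           `&` [set w | X n.+1 w <= x /\ J n.+1 w = j])
      = (P (cyl X J n B C `&` [set w | J n w = i]) * mu i j [set` `]-oo, x]])%E.
Hypothesis hstoch : forall i, (\sum_(j < d) mu i j setT = 1)%E.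
Hypothesis hirr : forall i j, exists n : nat,
      0 < ((\matrix_(a < d, b < d) fine (mu a b setT)) ^+ n) i j.
Hypothesis hvarpi_sum : \sum_(i < d) varpi 0 i = 1.
Hypothesis hvarpi_stat : varpi *m (\matrix_(a < d, b < d) fine (mu a b setT)) = varpi.
Hypothesis hint : forall i j, (mu i j).-integrable setT EFin.
Hypothesis hC : classC P T.
Hypothesis hET : (\int[P]_w (T w)%:E < +oo)%E.
Hypothesis hH : forall i j : 'I_d,
      (fun x => fine (mu i j [set y | x < `|y|]) / tailP P T x)
        @ +oo --> (0 : R).

Local Notation G := (tailP P T).
Local Notation h := (\sum_(i < d) varpi 0 i *
             \sum_(j < d) fine (\int[mu i j]_(y in setT) y%:E)).

Lemma kernel_mass i : \sum_(j < d) fine (mu i j setT) = 1.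
Proof.
rewrite sum_fine ?hstoch// => j _.
by rewrite ge0_fin_numE// (kernel_lty hstoch).
Qed.

(** Given state [i], the increment corrected by [g j - g i] has mean [h]. The Poisson equation is
    solvable because [varpi] annihilates [h - m], by the very definition of [h]. *)
Lemma centring : exists g : 'I_d -> R, forall i,
  \sum_(j < d) (fine (\int[mu i j]_y y%:E) + fine (mu i j setT) * g j) = h + g i.
Proof.
pose A := \matrix_(a < d, b < d) fine (mu a b setT).
pose m i : R := \sum_(j < d) fine (\int[mu i j]_(y in setT) y%:E).
have [||||||g gE] := @poisson_equation R d A _ _ _ varpi (\col_i (h - m i)).
- by move=> i j; rewrite mxE fine_ge0.
- by move=> i; under eq_bigr do rewrite mxE; exact: kernel_mass.
- exact: hirr.
- exact: hvarpi_stat.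
- apply/eqP => v0; move: hvarpi_sum; rewrite v0 big1 => [/eqP|i _].
    by rewrite eq_sym oner_eq0.
  by rewrite mxE.
- apply/rowP => i; rewrite !mxE.
  under eq_bigr do rewrite mxE mulrBr.
  by rewrite sumrB -mulr_suml hvarpi_sum mul1r subrr.
exists (fun i => g i 0) => i; rewrite big_split/= -/(m i).
have := congr1 (fun M : 'cV[R]_d => M i 0) gE; rewrite !mxE.
under [X in X - _ = _]eq_bigr do rewrite mxE.
lra.
Qed.

Lemma kernel_tail delta : 0 < delta ->
  \forall x \near +oo, forall i j, fine (mu i j [set y | x < `|y|]) <= delta * G x.
Proof.
move=> delta0; apply: filter_forall => i; apply: filter_forall => j.
have /cvgrPdist_le/(_ delta delta0)[M [_ HM]] := hH i j.
exists M; split; first exact: num_real.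
move=> x Mx; have := HM x Mx; rewrite /= sub0r normrN => /(le_trans (ler_norm _)).
by rewrite ler_pdivrMr// tailP_gt0.
Qed.

(** The bound without [G] serves the lower estimate of the sum, the one linear in [n] the upper
    estimate of the maximum. *)
Lemma deviation_small s eps delta : `|s| = 1 -> 0 < eps -> 0 < delta ->
  \forall x \near +oo, forall n, (P (deviation (X := X) h s eps n x) <= delta%:E)%E /\
    (P (deviation (X := X) h s eps n x) <= (delta * n.+1%:R * G x)%:E)%E.
Proof.
move=> s1 eps0 delta0.
have [g gE] := centring.
(* Thus [xi i j y = s * (y + g j - g i - h) - eps], of mean [- eps] from every state and for either
   sign. *)
pose c i j : R := s * (g j - g i - h) - eps.
pose xi i j y : R := s * y + c i j.
have mxi i j : measurable_fun setT (xi i j).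
  by apply: measurable_funD => //; exact: measurable_funM.
have [nu nuP] := choice (fun i => mixtureP (mu i) (xi i) (mxi i)).
have nuE i := (nuP i).2; have nuA i := (nuP i).1.
have nu1 i : nu i setT = 1%E.
  by rewrite nuA -(hstoch i); apply: eq_bigr => j _.
have cst_int i j (b : R) : (mu i j).-integrable setT (EFin \o (fun=> b)).
  apply: measurable_bounded_integrable => //; last exact: bounded_cst.
  exact: (kernel_lty hstoch).
have id_int i j : (mu i j).-integrable setT (EFin \o (fun y : R => s * y)).
  by apply: integrable_EFinZ; exact: hint.
have xi_int i j : (mu i j).-integrable setT (EFin \o xi i j).
  exact: integrable_EFinD.
have nu_int i := mixture_integrable (mu i) (xi i) (nu i) (xi_int i) (nuE i).
have nu_mean i : \int[nu i]_y y = - eps.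
  rewrite (mixture_mean (mu i) (xi i) (nu i) (xi_int i) (nuE i)).
  have -> : \sum_(j < d) \int[mu i j]_y xi i j y = \sum_(j < d)
      (s * (fine (\int[mu i j]_y y%:E) + fine (mu i j setT) * g j)
       - (s * (g i + h) + eps) * fine (mu i j setT)).
    apply: eq_bigr => j _; rewrite (RintegralD measurableT (id_int i j) (cst_int i j (c i j))).
    rewrite (RintegralZl (f := id) _ measurableT (hint i j)).
    by rewrite Rintegral_cst// /c /Rintegral; ring.
  by rewrite sumrB -!mulr_sumr gE kernel_mass; ring.
(* The corrections telescope to [s * (g (J k) - g (J 0))], at most [2 * Kg] in size. *)
pose Kg := \sum_(i < d) `|g i|.
have Kg_ge i : `|g i| <= Kg by rewrite /Kg (bigD1 i)//= lerDl sumr_ge0.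
have nu_tail i dl : 0 < dl -> \forall x \near +oo, fine (nu i [set y | x < y]) <= dl * G x.
  move=> dl0; have d_gt0 : (0 < d)%N by apply: leq_ltn_trans (ltn_ord i).
  have dR0 : 0 < d%:R :> R by rewrite ltr0n.
  have p2 : 0 < 2^-1 :> R by rewrite invr_gt0.
  have [D D0 GD] := consistent_dominated _ (tailP_noninc mT) (tailP_consistent mT hC) _ p2.
  (* Once [c i j <= x / 2], a modified step above [x] forces [|y| > x / 2]; [D] pays for halving the
     level and [d] for the sum over next states. *)
  pose dl' := dl / (d%:R * D).
  have dl'0 : 0 < dl' by rewrite divr_gt0// mulr_gt0.
  have tail2 := near_pinftyM _ _ p2 (kernel_tail _ dl'0).
  have c2 : \forall x \near +oo, forall j, 2 * c i j <= x.
    by apply: filter_forall => j; apply: nbhs_pinfty_ge; rewrite num_real.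
  near=> x.
  have c2x : forall j, 2 * c i j <= x by near: x.
  have GDx : G (2^-1 * x) <= D * G x by near: x.
  have tail2x : forall i j, fine (mu i j [set y | 2^-1 * x < `|y|]) <= dl' * G (2^-1 * x).
    by near: x.
  have mabs : measurable [set y : R | 2^-1 * x < `|y|].
    rewrite -[X in measurable X]setTI.
    have mn : measurable_fun setT (fun y : R => `|y|) by exact: normr_measurable.
    exact: (mn measurableT _ (measurable_ray (2^-1 * x))).
  have mpre j : measurable (xi i j @^-1` [set y | x < y]).
    by rewrite -[X in measurable X]setTI; exact: (mxi i j measurableT _ (measurable_ray x)).
  rewrite nuA -sum_fine; last first.
    by move=> j _; rewrite ge0_fin_numE// (kernel_lty hstoch).
  apply: (@le_trans _ _ (\sum_(j < d) dl' * (D * G x))); last first.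
    rewrite sumr_const card_ord -mulr_natl le_eqVlt; apply/orP; left; apply/eqP.
    by rewrite /dl'; field; rewrite !gt_eqF.
  apply: ler_sum => j _; apply: (@le_trans _ _ (dl' * G (2^-1 * x))); last by rewrite ler_pM2l.
  apply: le_trans (tail2x i j); apply: fine_le.
  - by rewrite ge0_fin_numE// (kernel_lty hstoch).
  - by rewrite ge0_fin_numE// (kernel_lty hstoch).
  apply: le_measure; rewrite ?inE// => y; rewrite /xi /= => xy.
  have sy : s * y <= `|y| by rewrite (le_trans (ler_norm _))// normrM s1 mul1r.
  by have := c2x j; lra.
have cross0 := crossing_cvg0 nu G (excess (P := P) (T := T)) eps (tailP_gt0 mT hC) (tailP_noninc mT)
  (tailP_consistent mT hC) excess_ge0 (excess_lower mT hC hET) (excess_upper mT hC hET)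
  (excess_cvg0 mT hC hET) eps0 nu1 nu_int nu_mean nu_tail.
have cross1 := crossing_small nu G (excess (P := P) (T := T)) eps (tailP_gt0 mT hC) (tailP_noninc mT)
  (tailP_consistent mT hC) excess_ge0 (excess_lower mT hC hET) (excess_upper mT hC hET)
  (excess_cvg0 mT hC hET) eps0 nu1 nu_int nu_mean nu_tail.
have walkE k w : walk (X := X) (J := J) (xi := xi) k w =
    s * (Ssum X k w - X 0%N w - k%:R * h) - k%:R * eps + s * (g (J k w) - g (J 0%N w)).
  elim: k => [|k IH].
    by rewrite /walk /Ssum big_ord0 big_nat1; ring.
  rewrite /walk big_ord_recr/= -/(walk _ _) [walk _ _]IH /Ssum.
  by rewrite [in RHS]big_nat_recr//= /xi /c -natr1; ring.
have dev_le n x : (P (deviation (X := X) h s eps n x) <= (crossing nu n (x - 2 * Kg))%:E)%E.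
  pose E := [set w | exists k, (0 <= k <= 0 + n)%N /\
    x - 2 * Kg < walk (X := X) (J := J) (xi := xi) k w].
  have mE : measurable E by exact: (measurable_walk_gt mX mJ mxi).
  have devE : deviation (X := X) h s eps n x `<=` E.
    move=> w [k [kn xk]]; exists k; split=> //; rewrite walkE.
    have : `|s * (g (J k w) - g (J 0%N w))| <= 2 * Kg.
      rewrite normrM s1 mul1r (le_trans (ler_normB _ _))//.
      by have := Kg_ge (J k w); have := Kg_ge (J 0%N w); lra.
    by rewrite ler_norml => /andP[]; lra.
  apply: (@le_trans _ _ (P E)).
    apply: le_measure; rewrite ?inE//.
    exact: (history_measurable mX mJ n _ (history_deviation h s eps n x)).
  have F0 : <<s cylinders X J 0 >> setT.
    by apply: sub_sigma_algebra; exact: cylinders_setT.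
  have nuE' i (f : R -> R) : measurable_fun setT f -> (forall y, 0 <= f y) ->
      (\int[nu i]_y (f y)%:E = \sum_(j < d) \int[mu i j]_y (f (xi i j y))%:E)%E.
    by move=> mf f0; apply: (nuE i (EFin \o f)) => //; exact/measurable_EFinP.
  have := walk_crossing mX mJ hMAP hstoch mxi nu1 nuE' n 0%N (x - 2 * Kg) setT F0.
  rewrite setTI => /le_trans; apply.
  rewrite (_ : (fun w => _) = cst (crossing nu n (x - 2 * Kg))%:E).
    rewrite integral_cst// -[leRHS]mule1 lee_wpmul2l ?lee_fin ?crossing_ge0//.
    exact: probability_le1.
  by apply/funext => w; rewrite /walk big_ord0 subr0.
(* Lowering the level by [2 * Kg] at most doubles [G], hence the use of [delta / 2] below. *)
have G2 := consistent_long_tailed _ (tailP_noninc mT) (tailP_consistent mT hC) (2 * Kg) 2^-1 ltac:(by rewrite invr_gt0).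
have delta2 : 0 < delta / 2 by rewrite divr_gt0.
have near0 := near_pinftyD (- (2 * Kg)) _ (cross0 _ delta0).
have near1 := near_pinftyD (- (2 * Kg)) _ (cross1 _ delta2).
near=> x => n; split; apply: le_trans (dev_le n x) _; rewrite lee_fin.
  by have : forall n, crossing nu n (x - 2 * Kg) <= delta by near: x.
have : forall n, crossing nu n (x - 2 * Kg) <= delta / 2 * n.+1%:R * G (x - 2 * Kg) by near: x.
move=> /(_ n)/le_trans; apply.
have Gx : (1 - 2^-1) * G (x - 2 * Kg) <= G (x + 2 * Kg) by near: x.
have Kg0 : 0 <= Kg by exact: sumr_ge0.
have Gx' : G (x + 2 * Kg) <= G x by apply: (tailP_noninc mT); lra.
have -> : delta / 2 * n.+1%:R * G (x - 2 * Kg) = delta * n.+1%:R * (2^-1 * G (x - 2 * Kg)) by ring.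
by apply: ler_wpM2l; [rewrite mulr_ge0// ltW|lra].
Unshelve. all: by end_near. Qed.

End deviation.

(** * Sums up to the random time *)

Section random_index.
Context {R : realType} {d0 : measure_display} {Omega : measurableType d0}.
Context {P : probability Omega R} {d : nat}.
Context {X : nat -> Omega -> R} {J : nat -> Omega -> 'I_d} {T : Omega -> R}.
Hypothesis mX : forall n, measurable_fun setT (X n).
Hypothesis mJ : forall n (i : 'I_d), measurable (J n @^-1` [set i]).
Hypothesis mT : measurable_fun setT T.
Hypothesis T_ge0 : forall w, 0 <= T w.
Hypothesis hindep : forall (A : set R) (n : nat) (B : nat -> set R) (C : nat -> set 'I_d),
      measurable A -> (forall k, measurable (B k)) ->
      P (T @^-1` A `&` cyl X J n B C) = (P (T @^-1` A) * P (cyl X J n B C))%E.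

Lemma measurable_time A : measurable A -> measurable (T @^-1` A).
Proof. by move=> mA; rewrite -[X in measurable X]setTI; exact: mT. Qed.

Lemma independent_history n A E : measurable A -> <<s cylinders X J n >> E ->
  P (T @^-1` A `&` E) = (P (T @^-1` A) * P E)%E.
Proof.
move=> mA FE; have mTA := measurable_time _ mA.
have [p p0 pE] : exists2 p, 0 <= p & P (T @^-1` A) = p%:E.
  exists (fine (P (T @^-1` A))); first exact: fine_ge0.
  by rewrite fineK// ge0_fin_numE// prob_lty.
rewrite pE setIC.
pose m2 : {measure set Omega -> \bar R} := mscale (NngNum p0) P.
apply: (history_unique mX mJ n (mrestr P mTA) m2 _ _ _ FE).
  apply: (@le_lt_trans _ _ (P setT)); last by apply: prob_lty.
  by apply: le_measure; rewrite ?inE//; exact: measurableI.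
move=> _ [B [C [mB ->]]].
transitivity (P (T @^-1` A) * P (cyl X J n B C))%E; last by rewrite pE.
by rewrite -hindep// setIC.
Qed.

Local Notation N w := (Num.truncn (T w)).
Local Notation slot n := (`[n%:R, n.+1%:R[%classic : set R).

Lemma time_slot w n : slot n (T w) -> N w = n.
Proof. by rewrite /= in_itv/= => ?; exact: truncn_def. Qed.

Lemma slot_time w : slot (N w) (T w).
Proof. by rewrite /= in_itv/= truncn_itv. Qed.

Lemma time_bigcup (A : set R) (E : nat -> set Omega) :
  T @^-1` A `&` [set w | E (N w) w] =
  \bigcup_n (T @^-1` (A `&` slot n) `&` E n).
Proof.
apply/seteqP; split=> [w [Aw Ew]|w [n _ [[Aw /time_slot Nw] Ew]]].
  by exists (N w) => //; split=> //; split=> //; exact: slot_time.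
by split=> //=; rewrite Nw.
Qed.

Lemma measurable_random_index (E : nat -> set Omega) : (forall n, measurable (E n)) ->
  measurable [set w | E (N w) w].
Proof.
move=> mE; have -> : [set w | E (N w) w] = T @^-1` setT `&` [set w | E (N w) w].
  by rewrite preimage_setT setTI.
rewrite time_bigcup; apply: bigcup_measurable => n _.
apply: measurableI => //; apply: measurable_time; apply: measurableI => //.
Qed.

Lemma measurable_truncn_time (c : nat -> R) : measurable_fun setT (fun w => c (N w)).
Proof.
move=> _ B mB; rewrite setTI.
have := measurable_random_index (fun n => [set w | B (c n)]).
apply=> n.
have [Bn|Bn] := pselect (B (c n)).
  by rewrite (_ : [set _ | _] = setT)//; apply/seteqP; split.
by rewrite (_ : [set _ | _] = set0)//; apply/seteqP; split.
Qed.

(** Independence is applied on each event where the integer part of [T] is [n]. The bound [c n] is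
    required only if [A] meets the slot of [n], so a lower bound on [T] becomes one on [n]. *)
Lemma random_index_le (A : set R) (E : nat -> set Omega) (c : nat -> R) :
  measurable A -> (forall n, <<s cylinders X J n >> (E n)) -> (forall n, 0 <= c n) ->
  (forall n t, A t -> slot n t -> (P (E n) <= (c n)%:E)%E) ->
  (P (T @^-1` A `&` [set w | E (N w) w]) <= \int[P]_(w in T @^-1` A) (c (N w))%:E)%E.
Proof.
move=> mA FE c0 Ec.
have mE n : measurable (E n) by exact: (history_measurable mX mJ n).
have mAs n : measurable (A `&` slot n) by exact: measurableI.
have mTA n := measurable_time _ (mAs n).
have AE : T @^-1` A = \bigcup_n T @^-1` (A `&` slot n).
  apply/seteqP; split=> [w Aw|w [n _ []]//].
  by exists (N w) => //; split=> //; exact: slot_time.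
have tAs : trivIset setT (fun n => T @^-1` (A `&` slot n)).
  by move=> i j _ _ [w [[_ /time_slot <-] [_ /time_slot <-]]].
rewrite time_bigcup [in leRHS]AE ge0_integral_bigcup//; last 2 first.
- by apply: measurable_funTS; apply/measurable_EFinP; exact: measurable_truncn_time.
- by move=> w _; rewrite lee_fin.
apply: (@le_trans _ _ (\sum_(0 <= n <oo) P (T @^-1` (A `&` slot n) `&` E n))%E).
  apply: measure_sigma_subadditive => //.
  - by move=> n; exact: measurableI.
  - by apply: bigcup_measurable => n _; exact: measurableI.
apply: lee_nneseries => // n _.
have -> : (\int[P]_(w in T @^-1` (A `&` slot n)) (c (N w))%:E =
    \int[P]_(w in T @^-1` (A `&` slot n)) (c n)%:E)%E.
  by apply: eq_integral => w; rewrite inE => -[_ /time_slot ->].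
rewrite integral_cst// (independent_history n)// muleC.
have [->|] := eqVneq (T @^-1` (A `&` slot n)) set0.
  by rewrite !measure0 !mule0.
move=> /set0P[w [Aw sw]].
by apply: lee_wpmul2r => //; exact: Ec sw.
Qed.

End random_index.

Section Smax.
Context {R : realType} {d0 : measure_display} {Omega : measurableType d0}.
Implicit Type X : nat -> Omega -> R.

Lemma Ssum_le_Smax X n w : Ssum X n w <= Smax X n w.
Proof. by rewrite /Smax big_mkord; exact: (le_bigmax _ (fun k : 'I_n.+1 => Ssum X k w) ord_max). Qed.

Lemma Smax_gtE X n y :
  [set w | y < Smax X n w] = \bigcup_(k in [set k | (k <= n)%N]) [set w | y < Ssum X k w].
Proof.
apply/seteqP; split=> w /=.
  move=> yS; apply: contrapT => nk; move: yS; apply/negP; rewrite -leNgt /Smax big_mkord.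
  have le k : (k <= n)%N -> Ssum X k w <= y.
    by move=> kn; rewrite leNgt; apply/negP => yk; apply: nk; exists k.
  by apply: bigmax_le => [|k _]; apply: le => //; rewrite -ltnS.
move=> [k kn yk]; apply: (lt_le_trans yk); rewrite /Smax big_mkord.
have kn' : (k < n.+1)%N by rewrite ltnS.
exact: (le_bigmax _ (fun k : 'I_n.+1 => Ssum X k w) (Ordinal kn')).
Qed.

End Smax.

Lemma ratio_cvg1 {R : realType} (F G : R -> R) : (forall x, 0 < G x) ->
  (forall eta, 0 < eta -> eta < 1 ->
    \forall x \near +oo, (1 - eta) * G x <= F x <= (1 + eta) * G x) ->
  F x / G x @[x --> +oo] --> (1 : R).
Proof.
move=> G0 FG; apply/cvgrPdist_le => eta eta0.
have e0 : 0 < Num.min eta 2^-1 by rewrite lt_min eta0 invr_gt0/=.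
have e1 : Num.min eta 2^-1 < 1 by rewrite gt_min invf_lt1 ?ltr1n ?orbT.
near=> x.
have /andP[lo up] : (1 - Num.min eta 2^-1) * G x <= F x <= (1 + Num.min eta 2^-1) * G x.
  by near: x; exact: FG.
have ele : Num.min eta 2^-1 * G x <= eta * G x by rewrite ler_pM2r// ge_min lexx.
rewrite distrC ler_distl ler_pdivlMr// ler_pdivrMr//; lra.
Unshelve. all: by end_near. Qed.

(** * Upper estimate for the maximum, lower estimate for the sum *)

Section asymptotics.
Context {R : realType} {d0 : measure_display} {Omega : measurableType d0}.
Context {P : probability Omega R} {d : nat}.
Context {X : nat -> Omega -> R} {J : nat -> Omega -> 'I_d}.
Context {T : Omega -> R} {h : R}.
Hypothesis mX : forall n, measurable_fun setT (X n).
Hypothesis mJ : forall n (i : 'I_d), measurable (J n @^-1` [set i]).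
Hypothesis mT : measurable_fun setT T.
Hypothesis h_gt0 : 0 < h.
Hypothesis hindep : forall (A : set R) (n : nat) (B : nat -> set R) (C : nat -> set 'I_d),
      measurable A -> (forall k, measurable (B k)) ->
      P (T @^-1` A `&` cyl X J n B C) = (P (T @^-1` A) * P (cyl X J n B C))%E.
Hypothesis hC : classC P T.
Hypothesis hET : (\int[P]_w (T w)%:E < +oo)%E.
Hypothesis hbeta : forall i : 'I_d,
      (fun x => fine (P [set w | x < `|X 0 w| /\ J 0 w = i]) / tailP P T x)
        @ +oo --> (0 : R).
Hypothesis dev_small : forall s eps delta, `|s| = 1 -> 0 < eps -> 0 < delta ->
  \forall x \near +oo, forall n, (P (deviation (X := X) h s eps n x) <= delta%:E)%E /\
    (P (deviation (X := X) h s eps n x) <= (delta * n.+1%:R * tailP P T x)%:E)%E.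

Local Notation G := (tailP P T).
Local Notation N w := (Num.truncn (T w)).

Lemma measurable_Ssum_gt k y : measurable [set w | y < Ssum X k w].
Proof.
have mS := history_Ssum (X := X) (J := J) k k (leqnn k).
have := mS measurableT _ (measurable_ray y); rewrite setTI.
exact: (history_measurable mX mJ k).
Qed.

Lemma measurable_Smax_gt n y : measurable [set w | y < Smax X n w].
Proof.
rewrite Smax_gtE; apply: bigcup_measurable => k _; exact: measurable_Ssum_gt.
Qed.

Lemma measurable_initial_gt y : measurable [set w | y < `|X 0%N w|].
Proof.
rewrite -[X in measurable X]setTI.
have mX0 : measurable_fun setT (fun w => `|X 0%N w|).
  by apply: measurableT_comp => //; exact: mX.
exact: (mX0 measurableT _ (measurable_ray y)).
Qed.

Lemma initial_small delta : 0 < delta ->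
  \forall x \near +oo, (P [set w | (x < `|X 0%N w|)%R] <= (delta * G x)%:E)%E.
Proof.
move=> delta0.
have d_gt0 : (0 < d)%N.
  (* Without states, [J 0] would force [Omega] to be empty. *)
  have [d0'|//] := posnP d.
  have PT : P setT = 1%E by exact: probability_setT.
  have ET : setT = set0 :> set Omega.
    apply/seteqP; split=> // w _.
    by have := leq_ltn_trans (leq0n _) (ltn_ord (J 0%N w)); rewrite [X in (_ < X)%N]d0'.
  by move: PT; rewrite ET measure0 => /eqP; rewrite eqe eq_sym oner_eq0.
have dR0 : 0 < d%:R :> R by rewrite ltr0n.
have H : \forall x \near +oo, forall i,
    fine (P [set w | x < `|X 0%N w| /\ J 0%N w = i]) <= delta / d%:R * G x.
  apply: filter_forall => i.
  have dd0 : 0 < delta / d%:R by rewrite divr_gt0.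
  have /cvgrPdist_le/(_ _ dd0)[M [_ HM]] := hbeta i.
  exists M; split; first exact: num_real.
  move=> x Mx; have := HM x Mx; rewrite /= sub0r normrN => /(le_trans (ler_norm _)).
  by rewrite ler_pdivrMr// tailP_gt0.
near=> x.
have Hx : forall i, fine (P [set w | x < `|X 0%N w| /\ J 0%N w = i]) <= delta / d%:R * G x.
  by near: x.
have mA := measurable_initial_gt x.
set A := [set w | _] in mA *.
have -> : P A = (\int[P]_(w in A) (cst 1%E) w)%E by rewrite integral_cst// mul1e.
rewrite (ge0_integral_state mJ 0%N)//.
apply: (@le_trans _ _ (\sum_(i < d) (delta / d%:R * G x)%:E)%E); last first.
  rewrite sumEFin lee_fin sumr_const card_ord -mulr_natl le_eqVlt; apply/orP; left; apply/eqP.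
  by field; rewrite gt_eqF.
apply: lee_sum => i _.
have mAi : measurable (A `&` [set w | J 0%N w = i]) by apply: measurableI => //; exact: mJ.
rewrite integral_cst// mul1e.
rewrite -[leLHS]fineK ?lee_fin; first exact: Hx.
by rewrite ge0_fin_numE// prob_lty.
Unshelve. all: by end_near. Qed.

Lemma integrable_truncn : (\int[P]_w (N w).+1%:R%:E <= (\int[P]_w T w + 1)%:E)%E.
Proof.
have i1 : P.-integrable setT (EFin \o cst (1 : R)).
  by apply: (integrable_bounded _ _ 1) => //; [exact: probability_setT|move=> w; rewrite /= normr1].
have i2 := integrable_EFinD _ _ (integrable_time mT hC hET) i1.
have -> : (\int[P]_w T w + 1)%:E = (\int[P]_w (T w + 1)%:E)%E.
  have <- : \int[P]_w (T w + 1) = \int[P]_w T w + 1.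
    rewrite (RintegralD measurableT (integrable_time mT hC hET) i1) Rintegral_cst//.
    rewrite mul1r; congr (_ + _); rewrite -[RHS]/(fine 1%E); congr fine.
    exact: probability_setT.
  by rewrite /Rintegral fineK//; exact: (integrable_fin_num measurableT i2).
apply: ge0_le_integral => //.
- apply/measurable_EFinP.
  exact: (measurable_truncn_time mT hC.1 (fun n => n.+1%:R)).
- exact: (measurable_int _ i2).
by move=> w _; rewrite lee_fin -natr1 lerD2r truncn_le hC.1.
Qed.

Lemma random_max_upper eta : 0 < eta ->
  \forall x \near +oo, fine (P [set w | h * x < Smax X (N w) w]) <= (1 + eta) * G x.
Proof.
(* [e <= 1/2] gives [1 <= (1 - e) * (1 + 2 * e)]. Of four shares [eta / 4], two go to [2 * e], one
   to [X_0] and one to the deviation. *)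
move=> eta0; pose e := Num.min 2^-1 (eta / 4).
have e0 : 0 < e by rewrite lt_min invr_gt0 ltr0n/= divr_gt0.
have e2 : e <= 2^-1 by rewrite ge_min lexx.
have e4 : e <= eta / 4 by rewrite ge_min lexx orbT.
have [v v1 Gv] := tailP_consistent mT hC e e0.
have v0 : 0 < v by exact: lt_trans v1.
(* The gap between [h x / v] and [h x] is [4 * rho * x]: one share each for [X_0], the extra slope
   over at most [x] steps and the deviation level, and one to spare. *)
pose rho := h * (1 - v^-1) / 4.
have vV1 : v^-1 < 1 by rewrite invf_lt1.
have vV0 : 0 < v^-1 by rewrite invr_gt0.
have rho0 : 0 < rho by rewrite divr_gt0// mulr_gt0// subr_gt0.
have [D D0 GD] := consistent_dominated _ (tailP_noninc mT) (tailP_consistent mT hC) rho rho0.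
pose m := \int[P]_w T w + 1.
have m1 : 1 <= m by rewrite lerDr; apply: Rintegral_ge0 => w _; exact: hC.1.
(* [D] brings [G (rho * x)] back to [G x], and [m] bounds the mean of the integer part of [T] plus
   1. As [1 <= m], the same bound covers [X_0]. *)
pose delta := eta / (4 * D * m).
have delta0 : 0 < delta by rewrite divr_gt0// !mulr_gt0//; lra.
have dev := near_pinftyM _ _ rho0 (dev_small 1 rho delta (normr1 _) rho0 delta0).
have ini := near_pinftyM _ _ rho0 (initial_small delta delta0).
have Gv' := near_pinftyM _ _ vV0 Gv.
near=> x.
have x0 : 0 <= x by near: x; apply: nbhs_pinfty_ge; rewrite num_real.
have dev_x : forall n, (P (deviation (X := X) h 1 rho n (rho * x)) <= delta%:E)%E /\
    (P (deviation (X := X) h 1 rho n (rho * x)) <= (delta * n.+1%:R * G (rho * x))%:E)%E.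
  by near: x.
have ini_x : (P [set w | (rho * x < `|X 0%N w|)%R] <= (delta * G (rho * x))%:E)%E by near: x.
have GDx : G (rho * x) <= D * G x by near: x.
have Gvx : (1 - e) * G (v^-1 * x) <= G (v * (v^-1 * x)) by near: x.
rewrite mulVKf ?gt_eqF// in Gvx.
pose A := [set t : R | t <= v^-1 * x].
have mA : measurable A by rewrite /A -set_itvNyc; exact: measurable_itv.
pose E n := deviation (X := X) h 1 rho n (rho * x).
have FE n : <<s cylinders X J n >> (E n) by exact: history_deviation.
have mEN : measurable [set w | E (N w) w].
  apply: (measurable_random_index mT hC.1) => n.
  exact: (history_measurable mX mJ n _ (FE n)).
have mSN : measurable [set w | h * x < Smax X (N w) w].
  apply: (measurable_random_index mT hC.1 (fun n => [set w | h * x < Smax X n w])) => n.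
  exact: measurable_Smax_gt.
have mI := measurable_initial_gt (rho * x).
have mTA : measurable (T @^-1` A) by exact: measurable_time.
have mTv := measurable_tail mT (v^-1 * x).
have incl : [set w | h * x < Smax X (N w) w] `<=`
    [set w | v^-1 * x < T w] `|` ([set w | rho * x < `|X 0%N w|] `|`
      (T @^-1` A `&` [set w | E (N w) w])).
  move=> w; rewrite -[_ w]/([set w' | h * x < Smax X (N w) w'] w) Smax_gtE => -[k /= kN Sk].
  have [Tw|Tw] := ltP (v^-1 * x) (T w); first by left.
  right; have [Xw|Xw] := ltP (rho * x) `|X 0%N w|; first by left.
  right; split=> //; exists k; split=> //.
  have kT : k%:R <= v^-1 * x.
    apply: le_trans Tw; apply: (@le_trans _ _ (N w)%:R); first by rewrite ler_nat.
    by rewrite truncn_le hC.1.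
  have X0 : X 0%N w <= rho * x by exact: le_trans (ler_norm _) Xw.
  have kh : k%:R * (h + rho) <= v^-1 * x * (h + rho) by rewrite ler_wpM2r// addr_ge0// ltW.
  have vr : v^-1 * x * rho <= x * rho.
    by rewrite -mulrA ler_piMl ?(ltW vV1)// mulr_ge0// ltW.
  have rE : 4 * (rho * x) = h * x - v^-1 * x * h by rewrite /rho; field; rewrite gt_eqF.
  have rx0 : 0 <= rho * x by rewrite mulr_ge0// ltW.
  by rewrite mul1r; lra.
have Grx0 : 0 <= G (rho * x) by apply: ltW; exact: (tailP_gt0 mT hC).
have delta_ge0 : 0 <= delta by exact: ltW.
have bound : (P (T @^-1` A `&` [set w | E (N w) w]) <= (delta * G (rho * x) * m)%:E)%E.
  have cn0 n : 0 <= delta * n.+1%:R * G (rho * x).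
    exact: (mulr_ge0 (mulr_ge0 delta_ge0 (ler0n _ _)) Grx0).
  apply: le_trans (random_index_le mX mJ mT hC.1 hindep A E
    (fun n => delta * n.+1%:R * G (rho * x)) mA FE cn0 _) _.
    by move=> n t _ _; exact: (dev_x n).2.
  have mN : measurable_fun setT (fun w => (N w).+1%:R : R).
    exact: (measurable_truncn_time mT hC.1 (fun n => n.+1%:R)).
  have mN' : measurable_fun setT (fun w => delta * (N w).+1%:R * G (rho * x)).
    exact: (measurable_truncn_time mT hC.1 (fun n => delta * n.+1%:R * G (rho * x))).
  apply: (@le_trans _ _ (\int[P]_w (delta * (N w).+1%:R * G (rho * x))%:E)%E).
    apply: ge0_subset_integral => //; first exact/measurable_EFinP.
    by move=> w _; rewrite lee_fin.
  have dG0 : 0 <= delta * G (rho * x) by exact: mulr_ge0.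
  under eq_integral do rewrite mulrAC EFinM.
  rewrite ge0_integralZl//; last exact/measurable_EFinP.
  rewrite [leRHS]EFinM lee_wpmul2l ?lee_fin//.
  exact: integrable_truncn.
have PS : (P [set w | (h * x < Smax X (N w) w)%R] <=
    (G (v^-1 * x))%:E + ((delta * G (rho * x))%:E + (delta * G (rho * x) * m)%:E))%E.
  apply: (@le_trans _ _ (P ([set w | v^-1 * x < T w] `|` ([set w | rho * x < `|X 0%N w|] `|`
      (T @^-1` A `&` [set w | E (N w) w]))))).
    apply: le_measure; rewrite ?inE//; do ?apply: measurableU => //.
    exact: measurableI.
  apply: le_trans (measureU2 _ _ _) _ => //.
    by apply: measurableU => //; exact: measurableI.
  rewrite -tailPE//; apply: leeD => //.
  apply: le_trans (measureU2 _ _ _) _ => //; first exact: measurableI.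
  exact: leeD.
have Pfin : P [set w | (h * x < Smax X (N w) w)%R] \is a fin_num.
  by rewrite ge0_fin_numE// prob_lty.
rewrite -lee_fin fineK//; apply: le_trans PS _; rewrite -!EFinD lee_fin.
have Gx0 := tailP_gt0 mT hC x.
have Gvx0 := tailP_gt0 mT hC (v^-1 * x).
have h1 : G (v^-1 * x) <= (1 + 2 * e) * G x.
  have : (1 - e) * G (v^-1 * x) * (1 + 2 * e) <= G x * (1 + 2 * e).
    by rewrite ler_wpM2r//; lra.
  have : 0 <= e * (1 - 2 * e) * G (v^-1 * x).
    by rewrite !mulr_ge0 ?(ltW e0) ?(ltW Gvx0)//; lra.
  lra.
have h2 : delta * G (rho * x) * m <= eta / 4 * G x.
  apply: (@le_trans _ _ (delta * (D * G x) * m)).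
    by rewrite ler_wpM2r ?(le_trans ler01)// ler_pM2l.
  by rewrite le_eqVlt; apply/orP; left; apply/eqP; rewrite /delta; field; rewrite !gt_eqF//; lra.
have h3 : delta * G (rho * x) <= delta * G (rho * x) * m.
  by rewrite ler_peMr//; exact: mulr_ge0.
have h4 : e * G x <= eta / 4 * G x by rewrite ler_wpM2r// ltW.
lra.
Unshelve. all: by end_near. Qed.

Lemma random_sum_lower eta : 0 < eta -> eta < 1 ->
  \forall x \near +oo, (1 - eta) * G x <= fine (P [set w | h * x < Ssum X (N w) w]).
Proof.
(* The final loss is [(1 - 2 * e) * (1 - e) >= 1 - 3 * e]. *)
move=> eta0 eta1; pose e := eta / 4.
have e0 : 0 < e by rewrite divr_gt0.
have [v v1 Gv] := tailP_consistent mT hC e e0.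
have v0 : 0 < v by exact: lt_trans v1.
pose gap := h * (1 - v^-1).
have gap0 : 0 < gap by rewrite mulr_gt0// subr_gt0 invf_lt1.
pose rho := gap / 8.
have rho0 : 0 < rho by rewrite divr_gt0.
have N1s : `|(-1 : R)| = 1 by rewrite normrN1.
(* Used at [y = n * rho]. Of the eight shares in [n * gap], three go to [X_0], the slope and the
   level; the other five must exceed [h / v], the loss from rounding [T] down to [n]. *)
have [M HM] : exists M, forall y, M < y -> [/\ h * v^-1 < 5 * y,
    forall n, (P (deviation (X := X) h (-1) rho n y) <= e%:E)%E &
    (P [set w | (y < `|X 0%N w|)%R] <= e%:E)%E].
  suff [M [_ HM]] : \forall y \near +oo, [/\ h * v^-1 < 5 * y,
    forall n, (P (deviation (X := X) h (-1) rho n y) <= e%:E)%E &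
    (P [set w | (y < `|X 0%N w|)%R] <= e%:E)%E] by exists M.
  have dev := dev_small (-1) rho e N1s rho0 e0.
  have ini := initial_small e e0.
  near=> y; split.
  - have : h * v^-1 / 5 < y by near: y; apply: nbhs_pinfty_gt; rewrite num_real.
    lra.
  - move=> n; have dev_y : forall n, (P (deviation (X := X) h (-1) rho n y) <= e%:E)%E /\
      (P (deviation (X := X) h (-1) rho n y) <= (e * n.+1%:R * G y)%:E)%E by near: y.
    exact: (dev_y n).1.
  - have ini_y : (P [set w | (y < `|X 0%N w|)%R] <= (e * G y)%:E)%E by near: y.
    apply: le_trans ini_y _; rewrite lee_fin ler_piMr ?(ltW e0)//.
    by rewrite -lee_fin -tailPE// probability_le1//; exact: measurable_tail.
near=> x.
have Gvx : (1 - e) * G x <= G (v * x) by near: x.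
(* If the slot of [n] meets [A] then [n > v * x - 1], so [n * rho] exceeds [M]. *)
have xM : M < (v * x - 1) * rho.
  rewrite -ltr_pdivrMr// ltrBrDr -ltr_pdivrMl//.
  by near: x; apply: nbhs_pinfty_gt; rewrite num_real.
pose A := [set t : R | v * x < t].
have mA : measurable A by exact: measurable_ray.
pose E n := [set w | Ssum X n w <= h * x].
have FE n : <<s cylinders X J n >> (E n).
  have mS := history_Ssum (X := X) (J := J) n n (leqnn n).
  have mr : measurable [set y : R | y <= h * x].
    by rewrite -set_itvNyc; exact: measurable_itv.
  by have := mS measurableT _ mr; rewrite setTI.
have PE n t : A t -> `[n%:R, n.+1%:R[%classic t -> (P (E n) <= (2 * e)%:E)%E.
  rewrite /A /= in_itv/= => At /andP[_ tn].
  have vxn : v * x < n%:R + 1 by rewrite natr1; exact: lt_trans tn.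
  have nM : M < n%:R * rho.
    by apply: lt_trans xM _; rewrite ltr_pM2r//; lra.
  have [y1 y2 y3] := HM _ nM.
  have mdev := history_measurable mX mJ n _ (history_deviation (X := X) (J := J) h (-1) rho n (n%:R * rho)).
  have mI := measurable_initial_gt (n%:R * rho).
  have incl : E n `<=` [set w | n%:R * rho < `|X 0%N w|] `|`
      deviation (X := X) h (-1) rho n (n%:R * rho).
    move=> w; rewrite /E /= => Sn.
    have [Xw|Xw] := ltP (n%:R * rho) `|X 0%N w|; [by left|right].
    exists n; split=> //.
    have X0 : - X 0%N w <= n%:R * rho by rewrite (le_trans (ler_norm _))// normrN.
    have hx : h * x < h * v^-1 * (n%:R + 1).
      by rewrite -mulrA ltr_pM2l// -ltr_pdivrMl ?invr_gt0// invrK.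
    have rE : n%:R * rho * 8 = n%:R * h - n%:R * (h * v^-1).
      by rewrite /rho /gap; field; rewrite gt_eqF.
    by lra.
  apply: (@le_trans _ _ (P ([set w | n%:R * rho < `|X 0%N w|] `|`
      deviation (X := X) h (-1) rho n (n%:R * rho)))).
    apply: le_measure; rewrite ?inE//; last exact: measurableU.
    exact: (history_measurable mX mJ n _ (FE n)).
  apply: le_trans (measureU2 _ _ _) _ => //.
  have -> : (2 * e)%:E = (e%:E + e%:E)%E by rewrite -EFinD; congr EFin; lra.
  exact: (leeD y3 (y2 n)).
have c0 (n : nat) : 0 <= 2 * e by lra.
have := random_index_le mX mJ mT hC.1 hindep A E (fun=> 2 * e) mA FE c0 PE.
have mTA : measurable (T @^-1` A) by exact: measurable_time.
rewrite integral_cst// => PA.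
have PAE : (P (T @^-1` A `&` [set w | E (N w) w]) <= (2 * e * G (v * x))%:E)%E.
  apply: le_trans PA _; rewrite [leRHS]EFinM lee_wpmul2l ?lee_fin ?(c0 0%N)//.
  by rewrite -tailPE.
have mEN : measurable [set w | E (N w) w].
  apply: (measurable_random_index mT hC.1) => n.
  exact: (history_measurable mX mJ n _ (FE n)).
have mSN : measurable [set w | h * x < Ssum X (N w) w].
  apply: (measurable_random_index mT hC.1 (fun n => [set w | h * x < Ssum X n w])) => n.
  exact: measurable_Ssum_gt.
have : ((G (v * x))%:E <= P [set w | (h * x < Ssum X (N w) w)%R] + (2 * e * G (v * x))%:E)%E.
  apply: le_trans (leeD (lexx _) PAE).
  apply: (@le_trans _ _ (P ([set w | h * x < Ssum X (N w) w] `|` (T @^-1` A `&` [set w | E (N w) w])))).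
    rewrite -tailPE//; apply: le_measure; rewrite ?inE//.
    - by apply: measurableU => //; exact: measurableI.
    move=> w Tw; have [Sw|Sw] := ltP (h * x) (Ssum X (N w) w); [by left|by right].
  by apply: measureU2 => //; exact: measurableI.
have Pfin : P [set w | (h * x < Ssum X (N w) w)%R] \is a fin_num.
  by rewrite ge0_fin_numE// prob_lty.
rewrite -[P [set w | (h * x < Ssum X (N w) w)%R]]fineK// -EFinD lee_fin => H.
have Gx0 := tailP_gt0 mT hC x.
clear c0.
have h1 : (1 - 2 * e) * ((1 - e) * G x) <= (1 - 2 * e) * G (v * x).
  by rewrite ler_wpM2l// /e; lra.
have h2 : 0 <= e * e * G x by rewrite !mulr_ge0// ltW.
have h3 : e * G x * 4 = eta * G x by rewrite /e; field.
have h4 : 0 < eta * G x by rewrite mulr_gt0.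
lra.
Unshelve. all: by end_near. Qed.

End asymptotics.

Theorem theorem3p5
  (R : realType) (d0 : measure_display) (Omega : measurableType d0)
  (P : probability Omega R) (d : nat)
  (X : nat -> Omega -> R) (J : nat -> Omega -> 'I_d)
  (mu : 'I_d -> 'I_d -> {measure set R -> \bar R})
  (varpi : 'rV[R]_d) (T : Omega -> R)
  (* measurability of the process and of T *)
  (mX : forall n, measurable_fun setT (X n))
  (mJ : forall n (i : 'I_d), measurable (J n @^-1` [set i]))
  (mT : measurable_fun setT T)
  (* Markov additive kernel: conditionally on the past up to time n and on
     J_n = i, P(X_{n+1} <= x, J_{n+1} = j | .) = H_{ij}(x) = mu i j (]-oo, x]) *)
  (hMAP : forall (n : nat) (B : nat -> set R) (C : nat -> set 'I_d)
            (i j : 'I_d) (x : R),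
      (forall k, measurable (B k)) ->
      P (cyl X J n B C `&` [set w | J n w = i]
           `&` [set w | X n.+1 w <= x /\ J n.+1 w = j])
      = (P (cyl X J n B C `&` [set w | J n w = i]) * mu i j [set` `]-oo, x]])%E)
  (* H(oo) is stochastic *)
  (hstoch : forall i, (\sum_(j < d) mu i j setT = 1)%E)
  (* H(oo) is irreducible *)
  (hirr : forall i j, exists n : nat,
      0 < ((\matrix_(a < d, b < d) fine (mu a b setT)) ^+ n) i j)
  (* varpi is the stationary probability vector of H(oo) *)
  (hvarpi_nn : forall i, 0 <= varpi 0 i)
  (hvarpi_sum : \sum_(i < d) varpi 0 i = 1)
  (hvarpi_stat : varpi *m (\matrix_(a < d, b < d) fine (mu a b setT)) = varpi)
  (* h = varpi (int x dH(x)) e is well defined, finite and positive *)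
  (hint : forall i j, (mu i j).-integrable setT EFin)
  (hpos : 0 < \sum_(i < d) varpi 0 i *
                \sum_(j < d) fine (\int[mu i j]_(y in setT) y%:E))
  (* T is independent of {(S_n, J_n)} (equivalently of {(X_n, J_n)}) *)
  (hindep : forall (A : set R) (n : nat) (B : nat -> set R) (C : nat -> set 'I_d),
      measurable A -> (forall k, measurable (B k)) ->
      P (T @^-1` A `&` cyl X J n B C) = (P (T @^-1` A) * P (cyl X J n B C))%E)
  (* T in class C, E[T] < oo *)
  (hC : classC P T)
  (hET : (\int[P]_w (T w)%:E < +oo)%E)
  (* tail conditions *)
  (hbeta : forall i : 'I_d,
      (fun x => fine (P [set w | x < `|X 0 w| /\ J 0 w = i]) / tailP P T x)
        @ +oo --> (0 : R))
  (hH : forall i j : 'I_d,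
      (fun x => fine (mu i j [set y | x < `|y|]) / tailP P T x)
        @ +oo --> (0 : R)) :
  let h := \sum_(i < d) varpi 0 i *
             \sum_(j < d) fine (\int[mu i j]_(y in setT) y%:E) in
  ((fun x => fine (P [set w | h * x < Ssum X (Num.truncn (T w)) w]) / tailP P T x)
     @ +oo --> (1 : R)) /\
  ((fun x => fine (P [set w | h * x < Smax X (Num.truncn (T w)) w]) / tailP P T x)
     @ +oo --> (1 : R)).
Proof.
set h := (X in let h := X in _) => /=.
have dev s eps delta (s1 : `|s| = 1) (eps0 : 0 < eps) (delta0 : 0 < delta) :=
  deviation_small mX mJ mT hMAP hstoch hirr hvarpi_sum hvarpi_stat hint hC hET hH
    s eps delta s1 eps0 delta0.
have G_gt0 := tailP_gt0 mT hC.
have fin A : measurable A -> P A \is a fin_num.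
  by move=> mA; rewrite ge0_fin_numE// prob_lty.
have mS y : measurable [set w | y < Ssum X (Num.truncn (T w)) w].
  apply: (measurable_random_index mT hC.1 (fun n => [set w | y < Ssum X n w])) => n.
  exact: (measurable_Ssum_gt mX mJ).
have mM y : measurable [set w | y < Smax X (Num.truncn (T w)) w].
  apply: (measurable_random_index mT hC.1 (fun n => [set w | y < Smax X n w])) => n.
  exact: (measurable_Smax_gt mX mJ).
(* As the sum is at most the maximum, a lower estimate for the former and an upper one for the
   latter settle both limits. *)
have SM y : fine (P [set w | y < Ssum X (Num.truncn (T w)) w]) <=
    fine (P [set w | y < Smax X (Num.truncn (T w)) w]).
  apply: fine_le; rewrite ?fin//; apply: le_measure; rewrite ?inE//.
  by move=> w /= /lt_le_trans; apply; exact: Ssum_le_Smax.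
have lower := random_sum_lower mX mJ mT hpos hindep hC hbeta dev.
have upper := random_max_upper mX mJ mT hpos hindep hC hET hbeta dev.
split; apply: ratio_cvg1 => // eta eta0 eta1.
all: have lo := lower _ eta0 eta1.
all: have up := upper _ eta0.
all: near=> x.
all: have SMx := SM (h * x).
  apply/andP; split; first by near: x.
  by apply: le_trans SMx _; near: x.
apply/andP; split; last by near: x.
by apply: le_trans SMx; near: x.
Unshelve. all: by end_near. Qed.
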